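(* Let $p$ be an odd prime, let $\tau\ge 1$ be an integer, and put $d=p^{\tau}(p-1)$. Let $C\ge 3$ be a constant with the following property: for every prime $p$ and every sequence of at least $Cp$ primitive vectors $v_1,v_2,\dots\in\mathbb{Z}_p^2$ there exist distinct indices $i_1,\dots,i_t$ with $1\le t\le p$ such that both entries of $v_{i_1}+\cdots+v_{i_t}$ are divisible by $p$ but at least one of them is not divisible by $p^2$. Consider the system \[ a_1x_1^d+\cdots+a_sx_s^d=0,\qquad b_1x_1^d+\cdots+b_sx_s^d=0 \] with $a_i,b_i\in\mathbb{Q}_p$. Assume that one of the following holds: (i) $\tau\ge 3$, $s>2\frac{p}{p-1}d^2-2d$, and $p\ge 7$; (ii) $\tau=2$, $s>2\frac{p}{p-1}d^2-2d$, and $p\ge \frac{C}{2}+4$; (iii) $\tau=1$, $s>\left(2\frac{p}{p-1}+\frac{C-3}{2p-2}\right)d^2-2d$, and $p\ge 5$. Then the system has a non-trivial $p$-adic solution, i.e. a solution $(x_1,\dots,x_s)\in\mathbb{Q}_p^s\setminus\{\mathbf 0\}$.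
   Context: A vector in $\mathbb{Z}_p^2$ is primitive if not all of its entries are divisible by $p$, i.e. its reduction in $\mathbb{F}_p^2$ is nonzero. (The paper shows such a constant exists with $C\le 9996$.) *)

(* Defs.v *)
From HB Require Import structures.
From mathcomp Require Import all_boot all_order all_algebra.
From mathcomp Require Import boolp reals.

Set Implicit Arguments.
Unset Strict Implicit.
Unset Printing Implicit Defensive.

Import Order.TTheory GRing.Theory Num.Theory.
Local Open Scope ring_scope.

(* The ring of p-adic integers as the inverse limit of the rings Z/p^(n+1)Z.
   The exponents start at 1 because 'Z_1 is not the trivial ring in MathComp;
   the n-th component is the residue modulo p^(n+1). *)
Record padic_int (p : nat) (p_pr : prime p) : Type := PadicInt {
  padic_res : forall n : nat, 'Z_(p ^ n.+1);
  padic_res_compat : forall n : nat,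
    (padic_res n.+1 : nat)%:R = padic_res n :> 'Z_(p ^ n.+1)
}.

Lemma padic_intP (p : nat) (p_pr : prime p) (x y : padic_int p_pr) :
  (forall n, padic_res x n = padic_res y n) -> x = y.
Proof.
case: x y => [x xP] [y yP] /= exy.
have {}exy : x = y by apply: functional_extensionality_dep.
by case: _ / exy yP => yP; congr PadicInt; apply: Prop_irrelevance.
Qed.

Lemma expn_gt1 (p n : nat) : prime p -> (1 < p ^ n.+1)%N.
Proof. by move=> p_pr; rewrite -{1}(exp1n n.+1) ltn_exp2r ?prime_gt1. Qed.

Section Reduction.
Context (M N : nat) (M_gt1 : (1 < M)%N) (N_gt1 : (1 < N)%N) (N_dvd_M : (N %| M)%N).

Lemma Zp_red_mod (k : nat) : ((k %% M)%N)%:R = k%:R :> 'Z_N.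
Proof. by rewrite -[RHS]Zp_nat_mod // -(modn_dvdm k N_dvd_M) Zp_nat_mod. Qed.

Lemma Zp_redD (x y : 'Z_M) :
  ((x + y)%R : nat)%:R = (x : nat)%:R + (y : nat)%:R :> 'Z_N.
Proof. by rewrite /= [X in (_ %% X)%N](Zp_cast M_gt1) Zp_red_mod natrD. Qed.

Lemma Zp_redM (x y : 'Z_M) :
  ((x * y)%R : nat)%:R = (x : nat)%:R * (y : nat)%:R :> 'Z_N.
Proof. by rewrite /= [X in (_ %% X)%N](Zp_cast M_gt1) Zp_red_mod natrM. Qed.

Lemma Zp_redN (x : 'Z_M) : ((- x)%R : nat)%:R = - (x : nat)%:R :> 'Z_N.
Proof. by apply/eqP; rewrite -addr_eq0 -Zp_redD addNr. Qed.
End Reduction.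

Lemma dvdn_expS (p n : nat) : (p ^ n.+1 %| p ^ n.+2)%N.
Proof. exact: dvdn_exp2l. Qed.

Definition padic_zero (p : nat) (p_pr : prime p) : padic_int p_pr :=
  @PadicInt p p_pr (fun=> 0) (fun=> erefl).

Definition padic_one (p : nat) (p_pr : prime p) : padic_int p_pr :=
  @PadicInt p p_pr (fun=> 1) (fun=> erefl).

Lemma padic_add_compat (p : nat) (p_pr : prime p) (x y : padic_int p_pr) (n : nat) :
  ((padic_res x n.+1 + padic_res y n.+1)%R : nat)%:R = padic_res x n + padic_res y n :> 'Z_(p ^ n.+1).
Proof.
rewrite -(padic_res_compat x n) -(padic_res_compat y n).
by apply: Zp_redD; rewrite ?expn_gt1 ?dvdn_expS.
Qed.

Definition padic_add (p : nat) (p_pr : prime p) (x y : padic_int p_pr) :=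
  @PadicInt p p_pr (fun n => padic_res x n + padic_res y n) (padic_add_compat x y).

Lemma padic_opp_compat (p : nat) (p_pr : prime p) (x : padic_int p_pr) (n : nat) :
  ((- padic_res x n.+1)%R : nat)%:R = - padic_res x n :> 'Z_(p ^ n.+1).
Proof.
rewrite -(padic_res_compat x n).
by apply: Zp_redN; rewrite ?expn_gt1 ?dvdn_expS.
Qed.

Definition padic_opp (p : nat) (p_pr : prime p) (x : padic_int p_pr) :=
  @PadicInt p p_pr (fun n => - padic_res x n) (padic_opp_compat x).

Lemma padic_mul_compat (p : nat) (p_pr : prime p) (x y : padic_int p_pr) (n : nat) :
  ((padic_res x n.+1 * padic_res y n.+1)%R : nat)%:R = padic_res x n * padic_res y n :> 'Z_(p ^ n.+1).
Proof.
rewrite -(padic_res_compat x n) -(padic_res_compat y n).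
by apply: Zp_redM; rewrite ?expn_gt1 ?dvdn_expS.
Qed.

Definition padic_mul (p : nat) (p_pr : prime p) (x y : padic_int p_pr) :=
  @PadicInt p p_pr (fun n => padic_res x n * padic_res y n) (padic_mul_compat x y).

HB.instance Definition _ (p : nat) (p_pr : prime p) :=
  gen_eqMixin (padic_int p_pr).
HB.instance Definition _ (p : nat) (p_pr : prime p) :=
  gen_choiceMixin (padic_int p_pr).

Lemma padic_addA p p_pr : associative (@padic_add p p_pr).
Proof. by move=> x y z; apply: padic_intP => n; apply: addrA. Qed.
Lemma padic_addC p p_pr : commutative (@padic_add p p_pr).
Proof. by move=> x y; apply: padic_intP => n; apply: addrC. Qed.
Lemma padic_add0 p p_pr : left_id (padic_zero p_pr) (@padic_add p p_pr).
Proof. by move=> x; apply: padic_intP => n; apply: add0r. Qed.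
Lemma padic_addN p p_pr :
  left_inverse (padic_zero p_pr) (@padic_opp p p_pr) (@padic_add p p_pr).
Proof. by move=> x; apply: padic_intP => n; apply: addNr. Qed.

HB.instance Definition _ (p : nat) (p_pr : prime p) :=
  GRing.isZmodule.Build (padic_int p_pr) (@padic_addA p p_pr)
    (@padic_addC p p_pr) (@padic_add0 p p_pr) (@padic_addN p p_pr).

Lemma padic_mulA p p_pr : associative (@padic_mul p p_pr).
Proof. by move=> x y z; apply: padic_intP => n; apply: mulrA. Qed.
Lemma padic_mulC p p_pr : commutative (@padic_mul p p_pr).
Proof. by move=> x y; apply: padic_intP => n; apply: mulrC. Qed.
Lemma padic_mul1 p p_pr : left_id (padic_one p_pr) (@padic_mul p p_pr).
Proof. by move=> x; apply: padic_intP => n; apply: mul1r. Qed.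
Lemma padic_mulD p p_pr :
  left_distributive (@padic_mul p p_pr) (@padic_add p p_pr).
Proof. by move=> x y z; apply: padic_intP => n; apply: mulrDl. Qed.
Lemma padic_one_neq0 (p : nat) (p_pr : prime p) :
  padic_one p_pr != padic_zero p_pr.
Proof.
by apply/eqP => /(congr1 (fun x => padic_res x 0)) /= /eqP; rewrite oner_eq0.
Qed.

HB.instance Definition _ (p : nat) (p_pr : prime p) :=
  GRing.Zmodule_isComNzRing.Build (padic_int p_pr) (@padic_mulA p p_pr)
    (@padic_mulC p p_pr) (@padic_mul1 p p_pr) (@padic_mulD p p_pr)
    (@padic_one_neq0 p p_pr).

Definition padic_unit (p : nat) (p_pr : prime p) : pred (padic_int p_pr) :=
  fun x => `[< exists y : padic_int p_pr, y * x = 1 >].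

Definition padic_inv (p : nat) (p_pr : prime p) (x : padic_int p_pr) :=
  if pselect (exists y : padic_int p_pr, y * x = 1) is left h
  then projT1 (cid h) else x.

Lemma padic_mulVx (p : nat) (p_pr : prime p) :
  {in @padic_unit p p_pr, left_inverse 1 (@padic_inv p p_pr) *%R}.
Proof.
move=> x /asboolP xU; rewrite /padic_inv; case: pselect => // h.
exact: projT2 (cid h).
Qed.
Lemma padic_unitPl (p : nat) (p_pr : prime p) (x y : padic_int p_pr) :
  y * x = 1 -> @padic_unit p p_pr x.
Proof. by move=> yx; apply/asboolP; exists y. Qed.
Lemma padic_inv_out (p : nat) (p_pr : prime p) :
  {in [predC @padic_unit p p_pr], @padic_inv p p_pr =1 id}.
Proof.
move=> x /asboolP xU; rewrite /padic_inv; case: pselect => // h.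
Qed.

HB.instance Definition _ (p : nat) (p_pr : prime p) :=
  GRing.ComNzRing_hasMulInverse.Build (padic_int p_pr)
    (@padic_mulVx p p_pr) (@padic_unitPl p p_pr) (@padic_inv_out p p_pr).

Lemma val_padic_resD p (p_pr : prime p) (x : padic_int p_pr) (n k : nat) :
  (padic_res x (n + k) = padic_res x n %[mod p ^ n.+1])%N.
Proof.
elim: k => [|k IHk]; first by rewrite addn0.
rewrite addnS -IHk -(padic_res_compat x (n + k)) val_Zp_nat ?expn_gt1 //.
by rewrite modn_dvdm // dvdn_exp2l // ltnS leq_addr.
Qed.

Lemma padic_res_neq0 p (p_pr : prime p) (x : padic_int p_pr) (n k : nat) :
  padic_res x n != 0 -> ~~ (p ^ n.+1 %| padic_res x (n + k))%N.
Proof.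
apply: contra; rewrite /dvdn val_padic_resD => /eqP h; apply/eqP/val_inj => /=.
by rewrite -[LHS](@modn_small _ (p ^ n.+1)) // -{2}(Zp_cast (expn_gt1 n p_pr)).
Qed.

Lemma padic_neq0 p (p_pr : prime p) (x : padic_int p_pr) :
  x != 0 -> exists n, padic_res x n != 0.
Proof.
move=> x0; apply: contrapT => xn; case/eqP: x0; apply: padic_intP => n.
by apply/eqP/negPn/negP => h; apply: xn; exists n.
Qed.

Lemma padic_integral (p : nat) (p_pr : prime p) (x y : padic_int p_pr) :
  x * y = 0 -> (x == 0) || (y == 0).
Proof.
move=> xy0; apply/norP => -[/padic_neq0 [n xn] /padic_neq0 [m ym]].
have {}xn := padic_res_neq0 m.+1 xn; have {}ym := padic_res_neq0 n.+1 ym.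
move: xy0 => /(congr1 (fun z => (padic_res z (n + m.+1) : nat))).
rewrite /= [X in (_ %% X)%N](Zp_cast (expn_gt1 _ p_pr)) => /eqP; rewrite -/(dvdn _ _).
rewrite (_ : (m + n.+1 = n + m.+1)%N) in ym; last by rewrite !addnS addnC.
set a := nat_of_ord (padic_res x _) in xn *.
set b := nat_of_ord (padic_res y _) in ym *.
have a_gt0 : (0 < a)%N by case: (a) xn => //; rewrite dvdn0.
have b_gt0 : (0 < b)%N by case: (b) ym => //; rewrite dvdn0.
rewrite pfactor_dvdn // ?muln_gt0 ?a_gt0 // lognM //.
move: xn ym; rewrite !pfactor_dvdn // -!leqNgt => xn ym h.
by have := leq_trans h (leq_add xn ym); rewrite addnS ltnNge leqW.
Qed.

HB.instance Definition _ (p : nat) (p_pr : prime p) :=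
  GRing.ComUnitRing_isIntegral.Build (padic_int p_pr) (@padic_integral p p_pr).

Definition padic (p : nat) (p_pr : prime p) : fieldType :=
  {fraction (padic_int p_pr)}.

Definition padic_int_dvd (p : nat) (p_pr : prime p) (u x : padic_int p_pr) : Prop :=
  exists z : padic_int p_pr, x = u * z.

Definition primitive_vec (p : nat) (p_pr : prime p)
    (v : 'rV[padic_int p_pr]_2) : Prop :=
  ~ (forall k : 'I_2, padic_int_dvd p%:R (v 0 k)).

(* Sequences are finite families 'I_N -> Z_q^2; the nonempty set I of indices
   plays the role of the distinct indices i_1, ..., i_t with t = #|I|. *)
Definition zero_sum_constant (R : realType) (C : R) : Prop :=
  forall (q : nat) (q_pr : prime q) (N : nat)
         (v : 'I_N -> 'rV[padic_int q_pr]_2),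
    C * q%:R <= N%:R ->
    (forall i : 'I_N, primitive_vec (v i)) ->
    exists I : {set 'I_N},
      [/\ (1 <= #|I| <= q)%N,
          forall k : 'I_2, padic_int_dvd q%:R ((\sum_(i in I) v i) 0 k)
        & exists k : 'I_2,
            ~ padic_int_dvd (q%:R ^+ 2) ((\sum_(i in I) v i) 0 k)].

(* Main.v *)
Require Import Defs.
From mathcomp Require Import all_boot all_order all_algebra.
From mathcomp Require Import generic_quotient boolp reals.
From mathcomp Require Import zify ring lra.

Import Order.TTheory GRing.Theory Num.Theory.
Local Open Scope ring_scope.
Set Implicit Arguments.
Unset Strict Implicit.
Unset Printing Implicit Defensive.

(* Put q = p^(tau+1). The d-th powers of units of Z_p are exactly 1 + q Z_p, so
   it suffices to bring the coefficient vectors (a_i, b_i) into a shape where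
   some subset of them sums to 0 mod q and contains two vectors that are
   linearly independent mod p: two of the variables then absorb the error. All
   three hypotheses give s > 2d(q - 1), and only this and p >= 5 are used; the
   constant C plays no further role.

   Normalisation (Davenport-Lewis). Among the systems p^(d k_i) v_i = N u_i with
   p^e | det N choose one minimising 2d (sum k_i) - s e. Minimality yields at
   least 2q - 1 vectors u_i not divisible by p, at least 4q - 3 not divisible by
   p^2, and at least q off every line mod p. The quantity is bounded below when
   no line contains more than half of the vectors, because the indices can then
   be matched into non-parallel pairs, each of nonzero determinant; otherwise a
   single form in more than d(q - 1) variables has to be solved.

   Zero sums. In the group ring F_p[(Z/q)^2] = F_p[X,Y]/(X^q, Y^q) a product of
   2q - 2 factors 1 - [v] is a multiple of the sum of all group elements, the
   factor being the coefficient of X^(q-1) Y^(q-1) in the product of the linear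
   forms of the v's. If it is nonzero, any further vector b lies in a zero-sum
   subset. As 1 - [p w] = (1 - [w])^p, a vector p w counts for p factors.
   Taking q/p - 1 vectors p w with the w's in a single direction mod p, or none
   of them if one direction is very frequent, every vector not divisible by p
   lies in a zero-sum subset. Two such subsets through independent vectors, using
   disjoint sets of p w's, either contain an independent pair already or are
   disjoint, and then their union is the subset looked for. *)

(** * Products of linear forms with a nonzero coefficient *)

Lemma exists_subset_card (T : finType) (A : {set T}) (n : nat) :
  (n <= #|A|)%N -> exists2 B : {set T}, B \subset A & #|B| = n.
Proof.
move=> n_le; have : (0 < #|[set B : {set T} | B \subset A & #|B| == n]|)%N.
  by rewrite cards_draws bin_gt0.
by case/card_gt0P => B; rewrite inE => /andP[BA /eqP ?]; exists B.
Qed.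

(** One step of a greedy matching: [x] comes from a largest colour class and [y] has any other
    colour. Their two classes lose an element each; a third class has fewer than half of the
    elements, being no larger than the class of [x] and disjoint from it and from [y]. *)
Lemma bichromatic_pair (T : finType) (C : eqType) (c : T -> C)
    (W : {set T}) (r : nat) :
  (r.+1.*2 <= #|W|)%N ->
  (forall x, x \in W -> #|[set y in W | c y == c x]| + r.+1 <= #|W|)%N ->
  exists x y, [/\ x \in W, y \in W, c x != c y,
    #|W| = #|W :\: [set x; y]|.+2 &
    forall z, z \in W :\: [set x; y] ->
      (#|[set t in W :\: [set x; y] | c t == c z]| + r
       <= #|W :\: [set x; y]|)%N].
Proof.
move=> W_ge Wcl; pose cl x := [set y in W | c y == c x].
have /card_gt0P[x0 x0W] : (0 < #|W|)%N by lia.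
have [x xW xmax0] := @arg_maxnP _ x0 [in W] (fun x => #|cl x|) x0W.
have xmax z : z \in W -> (#|cl z| <= #|cl x|)%N by move/xmax0.
have [y yW ycx] : exists2 y, y \in W & c x != c y.
  apply/exists_inP; rewrite -[X in is_true X]negbK negb_exists_in.
  apply/negP => /forall_inP same.
  suff: (#|W| <= #|cl x|)%N by have := Wcl x xW; rewrite -/(cl x); lia.
  apply/subset_leq_card/subsetP => y yW; rewrite inE yW /=.
  by have := same y yW; rewrite negbK eq_sym.
exists x, y; have xy : x != y by apply: contraNneq ycx => ->.
have Wxy : #|W| = #|W :\: [set x; y]|.+2.
  rewrite -(cardsID [set x; y] W) (setIidPr _) ?cards2 ?xy //.
  by apply/subsetP => t; rewrite !inE => /orP[]/eqP->.
split=> // z; rewrite !inE negb_or => /andP[/andP[zx zy] zW].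
set W' := W :\: _ in Wxy *.
have clW' u : u \in [set x; y] -> c z == c u ->
    (#|[set t in W' | c t == c z]| < #|cl u|)%N.
  move=> uxy zu; apply/proper_card/properP; split.
    by apply/subsetP => t; rewrite !inE (eqP zu) => /andP[/andP[_ ->] ->].
  exists u; first by move: uxy; rewrite !inE eqxx andbT => /orP[]/eqP->.
  by move: uxy; rewrite !inE => ->.
case: (altP (c z =P c x)) => [/eqP zx'|zx'].
  have := clW' x; rewrite !inE eqxx => /(_ isT zx').
  by have := Wcl x xW; rewrite -/(cl x); lia.
case: (altP (c z =P c y)) => [/eqP zy'|zy'].
  have := clW' y; rewrite !inE eqxx orbT => /(_ isT zy').
  by have := Wcl y yW; rewrite -/(cl y); lia.
have clz : (#|[set t in W' | c t == c z]| <= #|cl z|)%N.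
  by apply/subset_leq_card/subsetP => t; rewrite !inE => /andP[/andP[_ ->] ->].
have := Wcl z zW; have := xmax z zW; rewrite -/(cl z) => zlex zle.
have : (#|cl z| + #|cl x| < #|W|)%N.
  rewrite -cardsUI (_ : cl z :&: cl x = set0) ?cards0 ?addn0; last first.
    apply/setP => t; rewrite !inE; case: (t \in W) => //=.
    by apply/negP => /andP[/eqP->]; rewrite (negPf zx').
  apply/proper_card/properP; split.
    by apply/subsetP => t; rewrite !inE => /orP[]/andP[].
  by exists y => //; rewrite !inE yW /= negb_or ![c y == _]eq_sym zy' ycx.
lia.
Qed.

(** Induction on [r], removing two non-proportional forms [x] and [y]. If adjoining either one to
    [U] gave a zero coefficient, two neighbouring coefficients of the product over [U] would solve a
    homogeneous 2x2 system with nonzero determinant, against the induction hypothesis. *)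
Lemma coef_prod_neq0 (K : fieldType) (T : finType) (a b : T -> K) (n r : nat)
    (W : {set T}) :
  (forall x, x \in W -> b x != 0) ->
  (n + r.*2 <= #|W|)%N ->
  (forall x, x \in W -> #|[set y in W | a y / b y == a x / b x]| + r <= #|W|)%N ->
  exists2 U : {set T}, U \subset W /\ #|U| = (n + r)%N &
    (\prod_(i in U) ((a i)%:P * 'X + (b i)%:P))`_r != 0.
Proof.
elim: r W => [|r IHr] W b_neq0 W_ge Wcl.
  have [|U UW cardU] := @exists_subset_card _ W n; first by lia.
  exists U; first by rewrite addn0.
  rewrite -horner_coef0 horner_prod prodf_seq_neq0.
  apply/allP => i _; apply/implyP => iU.
  by rewrite hornerD hornerM hornerX !hornerC mulr0 add0r b_neq0 // (subsetP UW).
have [||x [y [xW yW xy cardW Wcl']]] := @bichromatic_pair _ _ (fun i => a i / b i) W r.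
- by lia.
- exact: Wcl.
have [|||U [UW cardU] Uneq0] := IHr (W :\: [set x; y]).
- by move=> z; rewrite inE => /andP[_]; apply: b_neq0.
- by lia.
- exact: Wcl'.
have coefU z : z \notin U ->
    (\prod_(i in z |: U) ((a i)%:P * 'X + (b i)%:P))`_r.+1 =
    a z * (\prod_(i in U) ((a i)%:P * 'X + (b i)%:P))`_r
    + b z * (\prod_(i in U) ((a i)%:P * 'X + (b i)%:P))`_r.+1.
  by move=> zU; rewrite big_setU1 //= mulrDl -mulrA coefD !coefCM coefXM.
have xU : x \notin U by apply/negP => /(subsetP UW); rewrite !inE eqxx.
have yU : y \notin U by apply/negP => /(subsetP UW); rewrite !inE eqxx orbT.
have WU z : z \in W -> z |: U \subset W.
  move=> zW; rewrite subUset sub1set zW /=.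
  by rewrite (subset_trans UW) // subsetDl.
have [] := eqVneq ((\prod_(i in x |: U) ((a i)%:P * 'X + (b i)%:P))`_r.+1) 0; last first.
  by move=> ?; exists (x |: U) => //; rewrite WU // cardsU1 xU cardU addnS.
have [] := eqVneq ((\prod_(i in y |: U) ((a i)%:P * 'X + (b i)%:P))`_r.+1) 0; last first.
  by move=> ?; exists (y |: U) => //; rewrite WU // cardsU1 yU cardU addnS.
rewrite !coefU // => ey ex; case/eqP: Uneq0; apply/eqP.
set P := _`_r in ex ey *; set Q := _`_r.+1 in ex ey.
have /eqP : (a x * b y - a y * b x) * P = 0.
  transitivity (b y * (a x * P + b x * Q) - b x * (a y * P + b y * Q)); first by ring.
  by rewrite ex ey !mulr0 subr0.
rewrite mulf_eq0 => /orP[|/eqP //]; rewrite subr_eq0 => /eqP axby.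
by move: xy; rewrite eqr_div ?b_neq0 // axby eqxx.
Qed.

(** * Zero sums modulo p^k via the group ring *)

Lemma coef_exp_1aX (K : comNzRingType) (a : K) (n l : nat) :
  ((1 + a%:P * 'X) ^+ n)`_l = a ^+ l *+ 'C(n, l).
Proof.
elim: n l => [|n IHn] l.
  by rewrite expr0 coef1 bin0n; case: l => [|l]; rewrite ?expr0.
rewrite exprS mulrDl mul1r coefD -mulrA coefCM coefXM !IHn.
case: l => [|l] /=; first by rewrite mulr0 addr0 !bin0.
by rewrite binS mulrnDr mulrnAr exprS.
Qed.

Lemma bin_addX_pchar (p k n l : nat) : prime p -> (l < p ^ k)%N ->
  ('C(p ^ k + n, l))%:R = ('C(n, l))%:R :> 'F_p.
Proof.
move=> p_pr lt_lq.
have coefC m : ('C(m, l))%:R = ((1 + 1%:P * 'X : {poly 'F_p}) ^+ m)`_l.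
  by rewrite coef_exp_1aX expr1n.
have q_pchar : [pchar {poly 'F_p}].-nat (p ^ k)%N.
  by rewrite pnatX pnatE // pchar_poly pchar_Fp.
by rewrite !coefC exprD exprDn_pchar // expr1n exprMn -rmorphXn expr1n mul1r
  mulrDl mul1r coefD coefXnM lt_lq addr0.
Qed.

(** Turns divisibility by q = p^k into a coefficient: multiplying (1 + X)^a by (1 + X)^(q-1) and
    reading off degree q - 1 gives the indicator of the zero class. *)
Lemma bin_pred_pchar (p k a : nat) : prime p ->
  ('C((p ^ k).-1 + a, (p ^ k).-1))%:R = (p ^ k %| a)%:R :> 'F_p.
Proof.
move=> p_pr; have q_gt0 : (0 < p ^ k)%N by rewrite expn_gt0 prime_gt0.
rewrite [in LHS](divn_eq a (p ^ k)) /dvdn; set r := (a %% _)%N.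
have lt_rq : (r < p ^ k)%N by rewrite ltn_mod.
elim: (_ %/ _)%N => [|c IHc].
  rewrite mul0n add0n; case: r lt_rq => [|r] lt_rq; first by rewrite addn0 binn.
  have -> : ((p ^ k).-1 + r.+1 = p ^ k + r)%N by lia.
  by rewrite bin_addX_pchar ?prednK // bin_small //; lia.
have -> : ((p ^ k).-1 + (c.+1 * p ^ k + r)
           = p ^ k + ((p ^ k).-1 + (c * p ^ k + r)))%N by lia.
by rewrite bin_addX_pchar ?prednK.
Qed.

(* [group_elt p a b] stands for the element (a, b) of the group ring of
   (Z/p^kZ)^2 over F_p: with t the outer variable and X the inner one, X t and
   t are the generators minus 1, so that the degree in t is the order of
   vanishing along the augmentation ideal. *)
Definition group_elt (p a b : nat) : {poly {poly 'F_p}} :=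
  (1 + ('X)%:P * 'X) ^+ a * (1 + 1%:P * 'X) ^+ b.

Lemma group_elt0 p : group_elt p 0 0 = 1.
Proof. by rewrite /group_elt !expr0 mulr1. Qed.

Lemma group_eltD p a b a' b' :
  group_elt p (a + a') (b + b') = group_elt p a b * group_elt p a' b'.
Proof. by rewrite /group_elt !exprD mulrACA. Qed.

(** Degree [i] in X forces the first factor to contribute exactly t^i, so a single double
    coefficient separates the two exponents. *)
Lemma coef_group_elt p a b i j :
  (group_elt p a b)`_(i + j)`_i = ('C(a, i))%:R * ('C(b, j))%:R.
Proof.
have i_ord : (i < (i + j).+1)%N by lia.
rewrite coefM coef_sum (bigD1 (Ordinal i_ord)) //= big1 ?addr0 => [|l nei].
  by rewrite addKn !coef_exp_1aX expr1n !mulr_natr !coefMn coefXn eqxx.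
rewrite !coef_exp_1aX expr1n mulr_natr !coefMn coefXn.
by rewrite eq_sym (negPf (_ : (l : nat) != i)) ?mul0rn // -val_eqE.
Qed.

Lemma group_elt_pchar p a b : prime p -> odd p ->
  (1 - group_elt p a b) ^+ p = 1 - group_elt p (p * a) (p * b).
Proof.
move=> p_pr p_odd.
have p_pchar : [pchar {poly {poly 'F_p}}].-nat p.
  by rewrite pnatE // pchar_poly pchar_poly pchar_Fp.
by rewrite exprDn_pchar // expr1n exprNn -signr_odd p_odd expr1 mulN1r
  exprMn -!exprM ![(p * _)%N]mulnC.
Qed.

(** The linear form of the vector (a, b), dehomogenised; up to sign it is the term of order one in t
    of [1 - group_elt p a b]. *)
Definition linear_poly (p a b : nat) : {poly 'F_p} :=
  (a%:R)%:P * 'X + (b%:R)%:P.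

Lemma one_sub_group_elt p a b : exists g : {poly {poly 'F_p}},
  1 - group_elt p a b = 'X * g /\ g`_0 = - linear_poly p a b.
Proof.
have coef0 : (1 - group_elt p a b)`_0 = 0.
  apply/polyP => i; rewrite coefB coef1 /=.
  rewrite /group_elt coefM big_ord1 !coef_exp_1aX !expr0 !bin0 /=.
  by rewrite mulr1 subrr coef0.
have /factor_theorem[g defg] : root (1 - group_elt p a b) 0.
  by rewrite /root horner_coef0 coef0.
exists g; have {}defg : 1 - group_elt p a b = 'X * g.
  by rewrite mulrC defg subr0.
split=> [//|]; have <- : (1 - group_elt p a b)`_1 = g`_0.
  by rewrite defg coefXM.
rewrite coefB coef1 sub0r /group_elt coefM big_ord_recl big_ord1 /=.
rewrite !coef_exp_1aX !expr0 !bin0 !bin1 !expr1 /= mul1r mulr1 /linear_poly.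
by rewrite !rmorph_nat mulr_natl addrC.
Qed.

(** Expanding the product gives a signed sum over subsets, and [phi] is additive, so it cannot
    vanish on every term. The factor [c] collects the chosen [g x] during the induction. *)
Lemma prod_one_sub_neq0 (K : comNzRingType) (V : zmodType) (phi : K -> V)
    (I : finType) (g : I -> K) (W : {set I}) (c : K) :
  {morph phi : a b / a - b} ->
  phi (\prod_(i in W) (1 - g i) * c) != 0 ->
  exists2 U : {set I}, U \subset W & phi (\prod_(i in U) g i * c) != 0.
Proof.
move=> phiB; elim: {W}_.+1 {-2}W (ltnSn #|W|) c => // n IHn W ltWn c.
have [->|[x xW]] := set_0Vmem W; first
  by rewrite big_set0 => nz; exists set0; rewrite ?sub0set ?big_set0.
rewrite (big_setD1 x) //= => nz.
have card_lt : (#|W :\ x| < n)%N by move: ltWn; rewrite (cardsD1 x W) xW.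
have [e|nz0] := eqVneq (phi (\prod_(i in W :\ x) (1 - g i) * c)) 0; last first.
  have [U UW Unz] := IHn _ card_lt _ nz0.
  by exists U => //; rewrite (subset_trans UW) // subD1set.
have nz1 : phi (\prod_(i in W :\ x) (1 - g i) * (g x * c)) != 0.
  move: nz; rewrite (_ : _ * _ * c = \prod_(i in W :\ x) (1 - g i) * c
    - \prod_(i in W :\ x) (1 - g i) * (g x * c)); last by ring.
  by rewrite phiB e sub0r oppr_eq0.
have [U UW Unz] := IHn _ card_lt _ nz1; exists (x |: U).
  by rewrite subUset sub1set xW (subset_trans UW) // subD1set.
rewrite big_setU1 /=; first by rewrite [g x * _]mulrC -mulrA.
by apply/negP => /(subsetP UW); rewrite !inE eqxx.
Qed.

(** The product of the [1 - g i] is a multiple of t^(2(q-1)), where multiplication by [g b] does not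
    change the value of [phi]. Expanding the product after that multiplication exhibits a subset
    whose sum together with [b] is zero. *)
Lemma zero_sum_through (p k : nat) (I : finType) (x y x' y' : I -> nat)
    (T J : {set I}) (b : I) :
  prime p -> odd p ->
  (forall j, j \in J -> x j = (p * x' j)%N /\ y j = (p * y' j)%N) ->
  [disjoint T & J] -> b \notin T :|: J ->
  (#|T| + p * #|J| = (p ^ k).-1 + (p ^ k).-1)%N ->
  (\prod_(i in T) linear_poly p (x i) (y i) *
   (\prod_(j in J) linear_poly p (x' j) (y' j)) ^+ p)`_(p ^ k).-1 != 0 ->
  exists2 U : {set I}, U \subset T :|: J &
    (p ^ k %| \sum_(i in b |: U) x i)%N && (p ^ k %| \sum_(i in b |: U) y i)%N.
Proof.
move=> p_pr p_odd Jp disTJ bTJ weight nz; set q1 := (p ^ k).-1 in weight nz *.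
pose g i := group_elt p (x i) (y i).
(* On group elements [phi] is the indicator of the zero class, and it kills every multiple of
   t^(2q-1). *)
pose phi (P : {poly {poly 'F_p}}) := (P * group_elt p q1 q1)`_(q1 + q1)`_q1.
have phiB : {morph phi : P Q / P - Q}.
  by move=> P Q; rewrite /phi mulrBl !coefB.
have phi_elt u v : phi (group_elt p u v) = ((p ^ k %| u) && (p ^ k %| v))%N%:R.
  rewrite /phi -group_eltD coef_group_elt ![(_ + q1)%N]addnC.
  by rewrite !bin_pred_pchar // -natrM mulnb.
have [G GE] := choice (fun i => one_sub_group_elt p (x i) (y i)).
have [H HE] := choice (fun i => one_sub_group_elt p (x' i) (y' i)).
pose Q := \prod_(i in T) G i * (\prod_(j in J) H j) ^+ p.
have QE : \prod_(i in T :|: J) (1 - g i) = 'X^(q1 + q1) * Q.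
  rewrite (eq_bigl [predU T & J]) => [|i]; last by rewrite !inE.
  rewrite bigU //=.
  have -> : \prod_(i in T) (1 - g i) = 'X^#|T| * \prod_(i in T) G i.
    rewrite -prodr_const -big_split /=; apply: eq_bigr => i _.
    by rewrite (GE i).1.
  have -> : \prod_(i in J) (1 - g i) = ('X^#|J| * \prod_(j in J) H j) ^+ p.
    rewrite -prodr_const -big_split /= -prodrXl; apply: eq_bigr => i iJ.
    by rewrite -(HE i).1 group_elt_pchar // /g (Jp i iJ).1 (Jp i iJ).2.
  by rewrite exprMn -exprM mulrACA -exprD [(_ * p)%N]mulnC weight.
have phiX (P : {poly {poly 'F_p}}) : phi ('X^((q1 + q1).+1) * P) = 0.
  by rewrite /phi -mulrA coefXnM ltnS leqnn coef0.
have phiQ : phi ('X^(q1 + q1) * Q) != 0.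
  rewrite /phi -mulrA coefXnM ltnn subnn coef0M.
  have -> : (group_elt p q1 q1)`_0 = 1.
    apply/polyP => i; rewrite /group_elt coef0M !coef_exp_1aX !expr0 !bin0.
    by rewrite mulr1.
  rewrite mulr1 /Q coef0M -!horner_coef0 horner_exp !horner_prod.
  under eq_bigr do rewrite horner_coef0 (GE _).2.
  under [X in X ^+ p]eq_bigr do rewrite horner_coef0 (HE _).2.
  (* The signs cancel because the total weight 2(q - 1) is even. *)
  rewrite !prodrN exprMn mulrACA -exprM -exprD mulnC weight.
  by rewrite -signr_odd addnn odd_double expr0 mul1r.
(* The extra factor [1 - g b] brings one more power of t, so [phi] vanishes on the product with
   it. *)
have phib : phi ('X^(q1 + q1) * Q * g b) != 0.
  have : phi ('X^(q1 + q1) * Q * (1 - g b)) = 0.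
    rewrite (GE b).1 (_ : _ * _ = 'X^((q1 + q1).+1) * (Q * G b)) ?phiX //.
    by rewrite exprSr; ring.
  by rewrite mulrBr mulr1 phiB => /eqP; rewrite subr_eq0 => /eqP <-.
rewrite -QE in phib; have [U UW] := prod_one_sub_neq0 phiB phib.
have bU : b \notin U by apply: contra bTJ => /(subsetP UW).
have -> : \prod_(i in U) g i * g b
    = group_elt p (\sum_(i in b |: U) x i) (\sum_(i in b |: U) y i).
  rewrite !big_setU1 //= group_eltD mulrC; congr (_ * _).
  elim/big_rec3: _ => [|i u v P _ ->]; first by rewrite group_elt0.
  by rewrite group_eltD.
rewrite phi_elt => zU; exists U => //; move: zU.
by case: (_ && _) => //; rewrite eqxx.
Qed.

(** * Zero sums containing two independent vectors modulo p *)

Definition parallel (p : nat) (I : Type) (x y : I -> nat) (i j : I) : bool :=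
  (x i)%:R * (y j)%:R == (y i)%:R * (x j)%:R :> 'F_p.

(** The members p w of [J], with w on the axis y = 0, contribute a constant times X^(q-h). It
    remains to pick q + h - 2 vectors of [S] other than [b] whose product of forms has a nonzero
    coefficient of index h - 1: [A], on the axis, supplies powers of X, and [U], off the axis, comes
    from [coef_prod_neq0]. *)
Lemma zero_sum_through_each_axis (p k h : nat) (I : finType)
    (x y x' y' : I -> nat) (S J : {set I}) (b : I) :
  prime p -> odd p ->
  (forall j, j \in J -> [/\ x j = (p * x' j)%N, y j = (p * y' j)%N,
     (x' j)%:R != 0 :> 'F_p & (y' j)%:R = 0 :> 'F_p]) ->
  [disjoint S & J] -> (0 < h)%N -> (p * #|J| + h)%N = (p ^ k)%N ->
  (forall i, i \in S -> (y i)%:R = 0 :> 'F_p -> (x i)%:R != 0 :> 'F_p) ->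
  (forall i, i \in S ->
     (p ^ k <= #|[set j in S | ~~ parallel p x y i j]|)%N) ->
  (p ^ k <= #|[set j in S | ((y j)%:R != 0 :> 'F_p)%R]|)%N ->
  (p ^ k + h.*2 <= (#|S| + #|[set j in S | ((y j)%:R == 0 :> 'F_p)%R]|).+1)%N ->
  b \in S ->
  exists2 U : {set I}, U \subset S :|: J /\ b \in U &
    (p ^ k %| \sum_(i in U) x i)%N && (p ^ k %| \sum_(i in U) y i)%N.
Proof.
move=> p_pr p_odd Jp disSJ h_gt0 pJh Sprim Scl offS largeS bS.
set q := (p ^ k)%N in pJh Scl offS largeS *.
set L0 := [set j in S | ((y j)%:R == 0 :> 'F_p)%R] in largeS.
set W0 := [set j in S | ((y j)%:R != 0 :> 'F_p)%R] in offS.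
have cardS : #|S| = (#|L0| + #|W0|)%N.
  rewrite -(cardsID L0 S); congr (_ + _)%N; apply/eq_card => j; rewrite !inE.
    by case: (j \in S).
  by case: (j \in S); rewrite ?andbT ?andbF.
pose L := L0 :\ b; pose W := W0 :\ b.
have cardL : (#|L0| <= #|L|.+1 /\ #|L| <= #|L0|)%N.
  by rewrite (cardsD1 b L0) -/L; case: (_ \in _); lia.
have cardW : #|W0| = ((b \in W0) + #|W|)%N by rewrite (cardsD1 b).
have cardLW : #|S| = (#|L| + #|W|).+1.
  rewrite cardS (cardsD1 b L0) (cardsD1 b W0) -/L -/W !inE bS.
  by case: (_ == 0) => /=; lia.
(* The number of the h - 1 powers of X that the axis vectors cannot supply; the truncated
   subtraction gives 0 when there are enough of them. *)
pose r := (h.-1 - #|L|)%N.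
have [||i iW|U [UW cardU] Uneq0] := @coef_prod_neq0 _ _ (fun i => (x i)%:R : 'F_p)
    (fun i => (y i)%:R) q.-1 r W.
- by move=> i; rewrite !inE => /and3P[].
- by rewrite /r; case: (b \in W0) cardW => /=; lia.
- have [iS yi] : i \in S /\ (y i)%:R != 0 :> 'F_p.
    by move: iW; rewrite !inE => /and3P[].
  set cl := [set _ in W | _].
  have clW : (#|cl| <= #|W|)%N.
    by apply/subset_leq_card/subsetP => j; rewrite inE => /andP[].
  have clS : (#|cl| + #|[set j in S | ~~ parallel p x y i j]| <= #|S|)%N.
    rewrite -(cardsID [set j in S | ~~ parallel p x y i j] S) addnC leq_add //.
      by apply/subset_leq_card/subsetP => j; rewrite !inE => /andP[->].
    apply/subset_leq_card/subsetP => j; rewrite !inE => /andP[/and3P[jb jS yj]].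
    by rewrite jS eqr_div // /parallel andbT /= negbK eq_sym [X in _ == X]mulrC.
  have := Scl i iS; rewrite /r; lia.
have [A AL cardA] : exists2 A : {set I}, A \subset L & #|A| = (h.-1 - r)%N.
  by apply: exists_subset_card; rewrite /r; lia.
have disUA : [disjoint U & A].
  rewrite -setI_eq0; apply/eqP/setP => j; rewrite !inE.
  apply/negP => /andP[/(subsetP UW) + /(subsetP AL)].
  by rewrite !inE => /and3P[_ _ /negPf->]; rewrite !andbF.
have UAS : U :|: A \subset S :\ b.
  apply/subsetP => j; rewrite !inE => /orP[/(subsetP UW)|/(subsetP AL)];
    by rewrite !inE => /and3P[-> ->].
have sumU (F : I -> {poly 'F_p}) :
    \prod_(i in U :|: A) F i = \prod_(i in U) F i * \prod_(i in A) F i.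
  rewrite (eq_bigl [predU U & A]) => [|i]; last by rewrite !inE.
  by rewrite bigU.
have [|||||V VUA Vsum] := @zero_sum_through p k I x y x' y' (U :|: A) J b p_pr p_odd.
- by move=> j /Jp[].
- apply: disjointWl disSJ; apply: subset_trans UAS _; exact: subD1set.
- rewrite inE negb_or; apply/andP; split.
    by apply/negP => /(subsetP UAS); rewrite !inE eqxx.
  by rewrite (disjointFr disSJ).
- rewrite cardsU (disjoint_setI0 disUA) cards0 subn0 cardU cardA -/q /r.
  have : (0 < q)%N by rewrite expn_gt0 prime_gt0.
  by lia.
- rewrite sumU.
  have -> : \prod_(i in A) linear_poly p (x i) (y i) =
      (\prod_(i in A) (x i)%:R)%:P * 'X^#|A|.
    rewrite -prodr_const rmorph_prod -big_split /=; apply: eq_bigr => i iA.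
    have := subsetP AL i iA; rewrite !inE => /and3P[_ _ /eqP yi].
    by rewrite /linear_poly yi polyC0 addr0.
  have -> : \prod_(i in J) linear_poly p (x' i) (y' i) =
      (\prod_(i in J) (x' i)%:R)%:P * 'X^#|J|.
    rewrite -prodr_const rmorph_prod -big_split /=; apply: eq_bigr => i iJ.
    by have [_ _ _ yi] := Jp i iJ; rewrite /linear_poly yi polyC0 addr0.
  set cA := \prod_(i in A) _; set cJ := \prod_(i in J) _.
  rewrite (_ : _ * _ * _ = \prod_(i in U) linear_poly p (x i) (y i)
      * (cA * cJ ^+ p)%:P * 'X^(#|A| + #|J| * p)); last first.
    by rewrite exprMn -exprM exprD polyCM polyC_exp; ring.
  rewrite coefMXn.
  have -> : ((p ^ k).-1 < #|A| + #|J| * p)%N = false.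
    by rewrite cardA -/q; lia.
  rewrite coefMC (_ : (_ - _)%N = r); last by rewrite cardA -/q /r; lia.
  rewrite mulf_neq0 // mulf_neq0 ?expf_neq0 // prodf_seq_neq0;
    apply/allP => i _; apply/implyP => iA.
    have := subsetP AL i iA; rewrite !inE => /and3P[_ iS /eqP yi].
    exact: Sprim.
  by have [] := Jp i iA.
exists (b |: V) => //; split; last by rewrite !inE eqxx.
rewrite subUset sub1set inE bS /=; apply: subset_trans VUA _.
by apply: setSU; apply: subset_trans UAS _; apply: subD1set.
Qed.

Definition primitive_mod (p a b : nat) : bool :=
  ((a%:R != 0 :> 'F_p) || (b%:R != 0 :> 'F_p)).

(** A point of the projective line over F_p, with [None] for the point at infinity. The zero vector
    also receives [None], so primitivity has to be recorded separately. *)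
Definition direction (p a b : nat) : option 'F_p :=
  if b%:R == 0 :> 'F_p then None else Some (a%:R / b%:R).

Definition zero_sum_mod (q : nat) (I : finType) (x y : I -> nat)
    (U : {set I}) : bool :=
  ((q %| \sum_(i in U) x i) && (q %| \sum_(i in U) y i))%N.

(** A linear change of coordinates moves the direction [c] to the axis y = 0. *)
Lemma zero_sum_through_each (p k h : nat) (I : finType)
    (x y x' y' : I -> nat) (S J : {set I}) (c : option 'F_p) (b : I) :
  prime p -> odd p ->
  (forall j, j \in J -> [/\ x j = (p * x' j)%N, y j = (p * y' j)%N,
     primitive_mod p (x' j) (y' j) & direction p (x' j) (y' j) = c]) ->
  [disjoint S & J] -> (0 < h)%N -> (p * #|J| + h)%N = (p ^ k)%N ->
  (forall i, i \in S -> primitive_mod p (x i) (y i)) ->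
  (forall i, i \in S ->
     (p ^ k <= #|[set j in S | ~~ parallel p x y i j]|)%N) ->
  (p ^ k <= #|S|)%N ->
  (p ^ k + h.*2 <=
    (#|S| + #|[set j in S | direction p (x j) (y j) == c]|).+1)%N ->
  b \in S ->
  exists2 U : {set I}, U \subset S :|: J /\ b \in U &
    zero_sum_mod (p ^ k) x y U.
Proof.
move=> p_pr p_odd Jp disSJ h_gt0 pJh Sprim Scl Sge largeS bS.
(* If some vector of [S] lies on the axis, all vectors not parallel to it are off the axis;
   otherwise the whole of [S] is. *)
have off (X Y : I -> nat) :
    (forall i, i \in S -> primitive_mod p (X i) (Y i)) ->
    (forall i, i \in S -> (p ^ k <= #|[set j in S | ~~ parallel p X Y i j]|)%N) ->
    (p ^ k <= #|[set j in S | ((Y j)%:R != 0 :> 'F_p)%R]|)%N.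
  move=> Xprim Xcl; have [i /andP[iS /eqP yi]|noS] := pickP [pred i | (i \in S) && ((Y i)%:R == 0 :> 'F_p)].
    apply: leq_trans (Xcl i iS) _; apply/subset_leq_card/subsetP => j.
    rewrite !inE /parallel yi mul0r mulf_eq0 negb_or => /and3P[-> _ ->] //.
  rewrite (_ : [set j in S | _] = S) //; apply/setP => j; rewrite inE.
  by case: (boolP (j \in S)) => //= jS; have := noS j; rewrite /= jS /= => ->.
case: c Jp largeS => [c|] Jp largeS; last first.
  have dirE a d : (direction p a d == None) = (d%:R == 0 :> 'F_p).
    by rewrite /direction; case: ifP.
  apply: (@zero_sum_through_each_axis p k h I x y x' y' S J b) => //.
  - move=> j /Jp[-> -> prim /eqP]; rewrite dirE => /eqP yj; split=> //.
    by move: prim; rewrite /primitive_mod yj eqxx orbF.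
  - by move=> i /Sprim; rewrite /primitive_mod => + yi; rewrite yi eqxx orbF.
  - exact: (off x y).
  - apply: leq_trans largeS _; rewrite ltnS leq_add2l subset_leq_card //.
    by apply/subsetP => j; rewrite !inE dirE.
(* A natural representative of -c, which keeps the new entries natural numbers. *)
pose c' : nat := (- c : 'F_p).
have c'E : c'%:R = - c :> 'F_p by rewrite natr_Zp.
have dir_c a d : direction p a d = Some c -> (a + c' * d)%:R = 0 :> 'F_p /\ d%:R != 0 :> 'F_p.
  rewrite /direction; case: ifP => // /negbT d0 [ac].
  by split=> //; rewrite natrD natrM c'E -ac mulNr divfK // subrr.
pose X i := y i; pose Y i := (x i + c' * y i)%N.
have YE i : (Y i)%:R = (x i)%:R - c * (y i)%:R :> 'F_p.
  by rewrite natrD natrM c'E mulNr.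
have XYpar i j : parallel p X Y i j = parallel p x y i j.
  rewrite /parallel !YE -subr_eq0 -[RHS]subr_eq0 -oppr_eq0.
  by congr (_ == 0); rewrite /X; ring.
have XYprim i : i \in S -> primitive_mod p (X i) (Y i).
  move=> /Sprim; rewrite /primitive_mod YE /X.
  by case: (eqVneq (y i)%:R (0 : 'F_p)) => //= ->; rewrite mulr0 subr0 orbF.
have XYcl i : i \in S -> (p ^ k <= #|[set j in S | ~~ parallel p X Y i j]|)%N.
  move=> iS; apply: leq_trans (Scl i iS) _; apply/subset_leq_card/subsetP => j.
  by rewrite !inE XYpar.
have [|||U UbU] := @zero_sum_through_each_axis p k h I X Y y'
  (fun j => x' j + c' * y' j)%N S J b p_pr p_odd _ disSJ h_gt0 pJh _ XYcl
  (off X Y XYprim XYcl) _ bS.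
- move=> j /Jp[xj yj prim /dir_c[xy0 y0]]; split=> //.
  by rewrite /Y xj yj; lia.
- by move=> i /XYprim; rewrite /primitive_mod => + yi; rewrite yi eqxx orbF.
- apply: leq_trans largeS _; rewrite ltnS leq_add2l subset_leq_card //.
  apply/subsetP => j; rewrite !inE => /andP[-> /eqP/dir_c[+ _]] /=.
  by rewrite /Y => ->.
move=> /andP[Uy Uxy]; exists U => //; rewrite /zero_sum_mod.
move: Uxy; rewrite big_split /= -big_distrr /= dvdn_addl => [->|]; first by rewrite Uy.
exact: dvdn_mull.
Qed.

(** The determinant of [i] and [j] annihilates both entries of the middle vector, one of which is
    nonzero mod p. *)
Lemma parallel_trans_mid (p : nat) (I : Type) (x y : I -> nat) (i t j : I) :
  primitive_mod p (x t) (y t) ->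
  parallel p x y i t -> parallel p x y j t -> parallel p x y i j.
Proof.
rewrite /parallel => tprim /eqP it /eqP jt; rewrite -subr_eq0.
set D := _ - _.
have Dy : D * (y t)%:R = 0.
  rewrite (_ : _ * _ = (x i)%:R * (y t)%:R * (y j)%:R
    - (x j)%:R * (y t)%:R * (y i)%:R); last by rewrite /D; ring.
  by rewrite it jt; ring.
have Dx : D * (x t)%:R = 0.
  rewrite (_ : _ * _ = (y j)%:R * (x t)%:R * (x i)%:R
    - (y i)%:R * (x t)%:R * (x j)%:R); last by rewrite /D; ring.
  by rewrite -it -jt; ring.
move/eqP: Dx; move/eqP: Dy; rewrite !mulf_eq0.
by case: (D == 0) => //= yt xt; move: tprim; rewrite /primitive_mod yt xt.
Qed.

(** If all of [U1] is parallel to [b1] and all of [U2] to [b2], a common member in [S] would make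
    [b1] and [b2] parallel. Outside [S] this argument fails, since such members may be zero mod p;
    there the disjointness of [J1] and [J2] takes over. *)
Lemma spanning_zero_sum (p q : nat) (I : finType) (x y : I -> nat)
    (S J1 J2 : {set I}) :
  [disjoint S & J1] -> [disjoint S & J2] -> [disjoint J1 & J2] ->
  (forall i, i \in S -> primitive_mod p (x i) (y i)) ->
  (forall i, i \in S -> exists2 j, j \in S & ~~ parallel p x y i j) ->
  S != set0 ->
  (forall b, b \in S -> exists2 U : {set I},
     U \subset S :|: J1 /\ b \in U & zero_sum_mod q x y U) ->
  (forall b, b \in S -> exists2 U : {set I},
     U \subset S :|: J2 /\ b \in U & zero_sum_mod q x y U) ->
  exists2 U : {set I}, zero_sum_mod q x y U &
    exists i j, [/\ i \in U, j \in U & ~~ parallel p x y i j].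
Proof.
move=> SJ1 SJ2 J12 Sprim Snp /set0Pn[b1 b1S] zs1 zs2.
have [b2 b2S b12] := Snp b1 b1S.
have [U1 [U1S b1U] zU1] := zs1 b1 b1S; have [U2 [U2S b2U] zU2] := zs2 b2 b2S.
have [/exists_inP[j jU nj]|/exists_inPn par1] :=
  boolP [exists j in U1, ~~ parallel p x y b1 j].
  by exists U1 => //; exists b1, j.
have [/exists_inP[j jU nj]|/exists_inPn par2] :=
  boolP [exists j in U2, ~~ parallel p x y b2 j].
  by exists U2 => //; exists b2, j.
have disU : [disjoint U1 & U2].
  rewrite -setI_eq0; apply/eqP/setP => t; rewrite !inE.
  apply/negP => /andP[t1 t2].
  move: (subsetP U1S t t1) (subsetP U2S t t2); rewrite !inE.
  have [tS _ _|tS /= tJ1 tJ2] := boolP (t \in S).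
    case/negP: b12; apply: parallel_trans_mid (Sprim t tS) _ _.
      by have := par1 t t1; rewrite negbK.
    by have := par2 t t2; rewrite negbK.
  by move/pred0P: J12 => /(_ t) /=; rewrite tJ1 tJ2.
exists (U1 :|: U2); last by exists b1, b2; rewrite !inE b1U b2U orbT.
have sumU (F : I -> nat) :
    (\sum_(i in U1 :|: U2) F i = \sum_(i in U1) F i + \sum_(i in U2) F i)%N.
  rewrite (eq_bigl [predU U1 & U2]) => [|i]; last by rewrite !inE.
  by rewrite bigU.
move/andP: zU1 => [x1 y1]; move/andP: zU2 => [x2 y2].
by rewrite /zero_sum_mod !sumU !dvdn_add.
Qed.

Lemma pigeonhole (T C : finType) (c : T -> C) (A : {set T}) (n : nat) :
  (n * #|C| < #|A|)%N -> exists z, (n < #|[set t in A | c t == z]|)%N.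
Proof.
move=> ltA; apply/existsP; apply: contraTT ltA => /existsPn small.
rewrite -leqNgt -sum1_card (partition_big c xpredT) //= mulnC -sum_nat_const.
apply: leq_sum => z _; rewrite sum1dep_card leqNgt; apply: contra (small z).
by rewrite cardsE.
Qed.

Lemma spanning_zero_sum_two_levels (p k : nat) (I : finType)
    (x y x' y' : I -> nat) (S M : {set I}) :
  prime p -> (4 < p)%N -> odd p -> (0 < k)%N ->
  (forall j, j \in M -> [/\ x j = (p * x' j)%N, y j = (p * y' j)%N &
     primitive_mod p (x' j) (y' j)]) ->
  [disjoint S & M] ->
  (forall i, i \in S -> primitive_mod p (x i) (y i)) ->
  (forall i, i \in S ->
     (p ^ k.+1 <= #|[set j in S | ~~ parallel p x y i j]|)%N) ->
  (2 * p ^ k.+1 <= #|S| + 1)%N -> (4 * p ^ k.+1 <= #|S| + #|M| + 3)%N ->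
  exists2 U : {set I}, zero_sum_mod (p ^ k.+1) x y U &
    exists i j, [/\ i \in U, j \in U & ~~ parallel p x y i j].
Proof.
move=> p_pr p_ge5 p_odd k_gt0 Mp disSM Sprim Scl S_ge SM_ge.
set P := (p ^ k)%N; have qE : (p ^ k.+1 = p * P)%N by rewrite expnS.
have P_ge : (p <= P)%N by rewrite -[p in (p <= _)%N]expn1 leq_exp2l; lia.
have q_gt0 : (0 < p ^ k.+1)%N by rewrite expn_gt0 prime_gt0.
have q_gtp : (5 * P <= p ^ k.+1)%N by rewrite qE leq_mul2r p_ge5 orbT.
have Snp i : i \in S -> exists2 j, j \in S & ~~ parallel p x y i j.
  move=> /Scl ge; have /card_gt0P[j] := leq_trans q_gt0 ge.
  by rewrite inE => /andP[]; exists j.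
have S0 : S != set0 by rewrite -card_gt0; lia.
have S_geq : (p ^ k.+1 <= #|S|)%N by lia.
have dis0 (A : {set I}) : [disjoint A & set0] by rewrite -setI_eq0 setI0.
pose dir j := direction p (x j) (y j).
pose dir' j := direction p (x' j) (y' j).
have card_dir : #|{: option 'F_p}| = p.+1 by rewrite card_option card_Fp.
(* With [J] empty and h = q, the requirement q + 2h of [zero_sum_through_each] is exactly this
   bound. *)
have [[c c_ge]|noc] := pselect (exists c,
    3 * p ^ k.+1 <= (#|S| + #|[set j in S | dir j == c]|).+1)%N.
  have zs b : b \in S -> exists2 U : {set I},
      U \subset S :|: set0 /\ b \in U & zero_sum_mod (p ^ k.+1) x y U.
    move=> bS; apply: (@zero_sum_through_each p k.+1 (p ^ k.+1)%N I x y x' y' S set0 c) => //.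
    - by move=> j; rewrite inE.
    - by rewrite cards0; lia.
    - by move: c_ge; rewrite /dir; lia.
  apply: (@spanning_zero_sum p _ I x y S set0 set0) => //.
(* A small [M] would make [S] so large that one of its p + 1 directions reaches the bound 3q just
   excluded. *)
have M_ge : (p ^ k.+1 + 2 * P <= #|M| + 2 * p + 2)%N.
  rewrite leqNgt; apply/negP => M_lt.
  have S_big : (3 * p ^ k.+1 + 2 * p <= #|S| + 2 * P)%N by lia.
  have [c c_gt] : exists c, (2 * P - 2 * p - 2 < #|[set j in S | dir j == c]|)%N.
    apply: pigeonhole; rewrite card_dir.
    by apply: (@leq_ltn_trans (2 * P * p.+1)%N); [rewrite leq_mul2r; lia|lia].
  by case: noc; exists c; lia.
(* More than (P - 2)(p + 1) vectors contain P - 1 with a common direction, and p(P - 1) + p = q, so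
   h = p. The bound on [M] still allows a second choice after P - 1 vectors are removed. *)
have pick (N : {set I}) : N \subset M -> (p ^ k.+1 + P <= #|N| + 2 * p + 1)%N ->
    exists J : {set I}, [/\ J \subset N, #|J| = P.-1 &
      forall b, b \in S -> exists2 U : {set I},
        U \subset S :|: J /\ b \in U & zero_sum_mod (p ^ k.+1) x y U].
  move=> NM N_ge.
  have [c c_gt] : exists c, (P.-2 < #|[set j in N | dir' j == c]|)%N.
    by apply: pigeonhole; rewrite card_dir; case: (P) P_ge q_gtp qE N_ge => [|[|P']] /=; lia.
  have [|J JN cardJ] := @exists_subset_card _ [set j in N | dir' j == c] P.-1.
    by lia.
  exists J; split=> //.
    by apply: subset_trans JN _; apply/subsetP => j; rewrite inE => /andP[].
  move=> b bS; apply: (@zero_sum_through_each p k.+1 p I x y x' y' S J c) => //.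
  - move=> j /(subsetP JN); rewrite inE => /andP[/(subsetP NM)/Mp[-> -> prim]].
    by move/eqP.
  - apply: disjointWr disSM; apply: subset_trans JN (subset_trans _ NM).
    by apply/subsetP => j; rewrite inE => /andP[].
  - exact: prime_gt0.
  - by rewrite cardJ qE; nia.
  - by nia.
have [|J1 [J1M cardJ1 zs1]] := pick M (subxx _); first by lia.
have [||J2 [J2M cardJ2 zs2]] := pick (M :\: J1).
- exact: subsetDl.
- by have := cardsID J1 M; rewrite (setIidPr J1M) cardJ1; lia.
apply: (@spanning_zero_sum p _ I x y S J1 J2) => //.
- exact: disjointWr J1M disSM.
- by apply: disjointWr disSM; apply: subset_trans J2M (subsetDl _ _).
rewrite disjoint_sym -setI_eq0; apply/eqP/setP => t; rewrite !inE.
by apply/negP => /andP[/(subsetP J2M)]; rewrite inE => /andP[/negPf->].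
Qed.

(** * Arithmetic of the p-adic integers *)

Section PadicIntegers.
Context (p : nat) (p_pr : prime p).
Local Notation Zp := (padic_int p_pr).

Definition pdvd (n : nat) (x : Zp) : Prop := exists z, x = p%:R ^+ n * z.

Lemma pdvd_exp n z : pdvd n (p%:R ^+ n * z). Proof. by exists z. Qed.

Lemma pdvd0 x : pdvd 0 x. Proof. by exists x; rewrite mul1r. Qed.

Lemma pdvdD n x y : pdvd n x -> pdvd n y -> pdvd n (x + y).
Proof. by move=> [u ->] [v ->]; exists (u + v); rewrite mulrDr. Qed.

Lemma pdvdMr n x y : pdvd n x -> pdvd n (x * y).
Proof. by move=> [u ->]; exists (u * y); rewrite mulrA. Qed.

Lemma pdvdN n x : pdvd n x -> pdvd n (- x).
Proof. by rewrite -mulrN1; apply: pdvdMr. Qed.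

Lemma pdvdB n x y : pdvd n x -> pdvd n y -> pdvd n (x - y).
Proof. by move=> xn /pdvdN; apply: pdvdD. Qed.

Lemma pdvdM m n x y : pdvd m x -> pdvd n y -> pdvd (m + n) (x * y).
Proof. by move=> [u ->] [v ->]; exists (u * v); rewrite exprD mulrACA. Qed.

Lemma pdvd_leq m n x : (m <= n)%N -> pdvd n x -> pdvd m x.
Proof.
by move=> /subnKC <- [z ->]; exists (p%:R ^+ (n - m) * z); rewrite exprD mulrA.
Qed.

Lemma pdvd_sum (I : Type) (r : seq I) (P : pred I) (F : I -> Zp) n :
  (forall i, P i -> pdvd n (F i)) -> pdvd n (\sum_(i <- r | P i) F i).
Proof.
move=> FP; elim/big_rec: _ => [|i x /FP Pi xn]; last exact: pdvdD.
by exists 0; rewrite mulr0.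
Qed.

Lemma natr_Zp_eq (n a b : nat) : (1 < n)%N -> (a = b %[mod n])%N ->
  a%:R = b%:R :> 'Z_n.
Proof. by move=> n_gt1 ab; rewrite -(Zp_nat_mod n_gt1 a) ab Zp_nat_mod. Qed.

Lemma padic_res_nat (m n : nat) : padic_res (m%:R : Zp) n = m%:R.
Proof.
elim: m => [//|m IHm]; rewrite -natr1 -[in RHS]natr1 -IHm.
exact: erefl.
Qed.

Lemma pdvdP n x : pdvd n.+1 x <-> padic_res x n = 0.
Proof.
have q_gt1 := expn_gt1 n p_pr.
split=> [[z ->]|x0].
  rewrite -natrX -[padic_res _ n]/(padic_res ((p ^ n.+1)%:R : Zp) n * padic_res z n).
  by rewrite padic_res_nat -(Zp_nat_mod q_gt1) modnn mul0r.
(* The quotient by p^(n+1) is built levelwise: its residue mod p^(m+1) is the residue of [x] mod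
   p^(m+n+2) divided by p^(n+1). *)
pose r m : nat := padic_res x (m + n.+1).
have rS m : (r m = r m.+1 %% p ^ (m + n.+1).+1)%N.
  rewrite /r addSn -[in LHS](padic_res_compat x) val_Zp_nat //.
  exact: expn_gt1.
have dvd_r m : (p ^ n.+1 %| r m)%N.
  by rewrite /dvdn /r addnS -addSn addnC val_padic_resD x0 mod0n.
have lt_r m : (r m %/ p ^ n.+1 < p ^ m.+1)%N.
  rewrite ltn_divLR ?expn_gt0 ?prime_gt0 // -expnD addSn.
  by rewrite -[X in (_ < X)%N](Zp_cast (expn_gt1 (m + n.+1) p_pr)) ltn_ord.
have z_compat m : (((r m.+1 %/ p ^ n.+1)%N%:R : 'Z_(p ^ m.+2)) : nat)%:R
    = (r m %/ p ^ n.+1)%N%:R :> 'Z_(p ^ m.+1).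
  rewrite val_Zp_nat ?expn_gt1 // modn_small //.
  apply: natr_Zp_eq; first exact: expn_gt1.
  rewrite (rS m) [in LHS](divn_eq (r m.+1) (p ^ (m + n.+1).+1)).
  rewrite -addSn expnD mulnA divnMDl ?expn_gt0 ?prime_gt0 //.
  by rewrite modnMDl.
exists (PadicInt p_pr z_compat); apply: padic_intP => m.
rewrite -natrX -[padic_res (_ * _) m]/(padic_res ((p ^ n.+1)%:R : Zp) m * (r m %/ p ^ n.+1)%N%:R).
rewrite padic_res_nat -natrM mulnC divnK // -[LHS]natr_Zp /r.
apply: natr_Zp_eq; first exact: expn_gt1.
by rewrite val_padic_resD.
Qed.

Lemma padic_approx (x : Zp) n : exists m : nat, pdvd n (x - m%:R).
Proof.
exists (padic_res x n); apply: pdvd_leq (leqnSn n) _; apply/pdvdP.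
rewrite -[padic_res _ n]/(padic_res x n - padic_res _ n) padic_res_nat.
by rewrite natr_Zp subrr.
Qed.

Lemma pdvd_nat n m : pdvd n (m%:R) <-> (p ^ n %| m)%N.
Proof.
split=> [|/dvdnP[c ->]]; last by exists c%:R; rewrite mulnC natrM natrX.
case: n => [|n] //; move/pdvdP; rewrite padic_res_nat.
by move/(congr1 val); rewrite /= val_Zp_nat ?expn_gt1 // => /eqP.
Qed.

Lemma pdvd_natr_congr n (x : Zp) m : pdvd n (x - m%:R) ->
  (pdvd n x <-> (p ^ n %| m)%N).
Proof.
move=> xm; rewrite -pdvd_nat; split=> [xn|mn].
  by rewrite (_ : m%:R = x - (x - m%:R)); [exact: pdvdB|ring].
by rewrite (_ : x = (x - m%:R) + m%:R); [exact: pdvdD|ring].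
Qed.

Lemma padic_separated (x : Zp) : (forall n, pdvd n x) -> x = 0.
Proof. by move=> xn; apply: padic_intP => n; apply/pdvdP. Qed.

Lemma padic_complete (f : nat -> Zp) : (forall n, pdvd n.+1 (f n.+1 - f n)) ->
  exists l, forall n, pdvd n.+1 (l - f n).
Proof.
move=> fP.
have compat n : (padic_res (f n.+1) n.+1 : nat)%:R = padic_res (f n) n
    :> 'Z_(p ^ n.+1).
  rewrite padic_res_compat; apply/eqP; rewrite -subr_eq0; apply/eqP.
  by have /pdvdP := fP n.
exists (PadicInt p_pr compat) => n; apply/pdvdP.
by rewrite -[padic_res _ n]/(padic_res (f n) n - padic_res (f n) n) subrr.
Qed.

Lemma horner_sub (K : comNzRingType) (Q : {poly K}) (a b : K) :
  exists w, Q.[a] - Q.[b] = (a - b) * w.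
Proof.
have /factor_theorem[g Qg] : root (Q - (Q.[b])%:P) b.
  by rewrite /root !hornerE subrr.
exists g.[a]; have := congr1 (horner^~ a) Qg.
by rewrite !hornerE mulrC.
Qed.

(* z |-> p Q(z) + c is a contraction. *)
Lemma padic_fixed_point (Q : {poly Zp}) (c : Zp) :
  exists z, z = p%:R * Q.[z] + c.
Proof.
pose g z := p%:R * Q.[z] + c.
have gP n a b : pdvd n (a - b) -> pdvd n.+1 (g a - g b).
  have [w abw] := horner_sub Q a b.
  rewrite (_ : g a - g b = p%:R ^+ 1 * ((a - b) * w)); last first.
    by rewrite -abw /g; ring.
  by move=> ab; rewrite -add1n; apply/pdvdM/pdvdMr; [rewrite -[_ ^+ 1]mulr1; exact: pdvd_exp|].
pose f n := iter n g c.
have [|l lP] := @padic_complete f.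
  elim=> [|n IHn]; last exact: gP.
  by exists Q.[c]; rewrite /= /g expr1 addrK.
exists l; apply/eqP; rewrite -subr_eq0 -/(g l); apply/eqP/padic_separated => n.
apply: (@pdvd_leq _ n.+2); first by lia.
rewrite (_ : l - g l = (l - f n.+1) - (g l - g (f n))); last first.
  by rewrite [f n.+1]/=; ring.
by apply: pdvdB; [exact: lP|exact/gP/lP].
Qed.

(** Bezout for a natural approximation of [x] gives [u] with x u = 1 + p t; the inverse of 1 + p t
    is a fixed point of z = 1 - p t z. *)
Lemma padic_unit_inv (x : Zp) : ~ pdvd 1 x -> exists z, x * z = 1.
Proof.
move=> x1; have [m xm] := padic_approx x 1.
have m_p : ~~ (p ^ 1 %| m)%N by apply/negP => /(pdvd_natr_congr xm).
have co : coprime m p by rewrite coprime_sym prime_coprime // -[p]expn1.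
have m_gt0 : (0 < m)%N by case: m m_p {xm co} => //; rewrite dvdn0.
have [u v uv _] := egcdnP p m_gt0; rewrite (eqP co) in uv.
case: xm => c xmc.
have xu : x * u%:R = 1 + p%:R * (v%:R + c * u%:R).
  rewrite (_ : x = m%:R + p%:R * c); last by rewrite -[p%:R]expr1 -xmc; ring.
  have := congr1 (GRing.natmul (1 : Zp)) uv; rewrite natrD !natrM => e.
  rewrite mulrDl [m%:R * _]mulrC e; ring.
have [z zE] := padic_fixed_point (- (v%:R + c * u%:R) *: 'X) 1.
exists (u%:R * z); rewrite mulrA xu; move: zE; rewrite hornerZ hornerX => zE.
by rewrite mulrDl mul1r {1}zE; ring.
Qed.

Lemma padic_val (x : Zp) : x != 0 -> exists n u, x = p%:R ^+ n * u /\ ~ pdvd 1 u.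
Proof.
move=> x0; have [n xn] : exists n, `[< ~ pdvd n x >].
  have [n xn] := padic_neq0 x0; exists n.+1; apply/asboolP => /pdvdP xn0.
  by rewrite xn0 eqxx in xn.
have ex : exists n, `[< ~ pdvd n x >] by exists n.
case: (ex_minnP ex) => {xn}n /asboolP xn nmin.
case: n xn nmin => [|n] xn nmin; first by case: xn; exact: pdvd0.
have [z xz] : pdvd n x.
  by apply: contrapT => nx; have := nmin n; rewrite ltnn => /(_ (asboolT nx)).
exists n, z; split=> // z1; apply: xn; rewrite xz -addn1.
by apply: pdvdM => //; rewrite -[_ ^+ n]mulr1; exact: pdvd_exp.
Qed.

Lemma p_neq0 : p%:R != 0 :> Zp.
Proof.
apply/eqP => p0; have : pdvd 2 (p%:R) by exists 0; rewrite mulr0.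
move/pdvd_nat; rewrite -[X in (_ %| X)%N]expn1 dvdn_Pexp2l //.
exact: prime_gt1.
Qed.

Lemma pdvd_cancel m n (x : Zp) : pdvd (m + n) (p%:R ^+ m * x) -> pdvd n x.
Proof.
move=> [z]; rewrite exprD -mulrA => /mulfI-/(_ (expf_neq0 _ p_neq0)) ->.
exact: pdvd_exp.
Qed.

(** Cubic precision suits p-th powers: for h = p^(tau+1) W and odd p, the quadratic term gains a
    factor p from C(p, 2), so that it and h^3 are both multiples of p^(tau+3). *)
Lemma exp_1D_trunc (K : comNzRingType) (h : K) n : exists r,
  (1 + h) ^+ n = 1 + n%:R * h + ('C(n, 2))%:R * h ^+ 2 + h ^+ 3 * r.
Proof.
elim: n => [|n [r IHn]]; first by exists 0; rewrite bin_small // expr0; ring.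
exists (r + ('C(n, 2))%:R + h * r); rewrite exprS IHn binS bin1 natrD -natr1.
ring.
Qed.

Lemma exp_prime_power (tau : nat) : odd p -> exists Q : {poly Zp},
  (1 + p%:R * 'X) ^+ (p ^ tau) = 1 + p%:R ^+ tau.+1 * ('X + p%:R * Q).
Proof.
move=> p_odd; elim: tau => [|tau [Q IH]]; first by exists 0; rewrite mulr0 addr0.
set W := 'X + _ in IH; rewrite expnSr exprM IH.
have [r ->] := exp_1D_trunc (p%:R ^+ tau.+1 * W) p.
have /dvdnP[c ->] : (p %| 'C(p, 2))%N.
  by rewrite prime_dvd_bin //= ltn_neqAle prime_gt1 // andbT; apply: contraTneq p_odd => <-.
exists (Q + p%:R ^+ tau * c%:R * W ^+ 2 + p%:R ^+ (tau + tau) * W ^+ 3 * r).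
have -> : forall u v, 'X + p%:R * (Q + u + v) = W + p%:R * (u + v).
  by move=> u v; rewrite /W; ring.
by rewrite natrM exprD !exprS; ring.
Qed.

(** Put y = 1 + p z. As p - 1 is -1 mod p, y^d has the form 1 + p^(tau+1) (p B(z) - z), and p B(z) -
    z = c is a fixed-point equation for a contraction. *)
Lemma padic_dth_root (tau : nat) (c : Zp) : odd p ->
  exists2 y : Zp, y != 0 & y ^+ (p ^ tau * (p - 1)) = 1 + p%:R ^+ tau.+1 * c.
Proof.
move=> p_odd; have [Q QE] := exp_prime_power tau p_odd.
have [r rE] := exp_1D_trunc (p%:R ^+ tau.+1 * ('X + p%:R * Q)) (p - 1).
have p1 : (p - 1)%:R = p%:R - 1 :> {poly Zp} by rewrite natrB // prime_gt0.
pose W : {poly Zp} := 'X + p%:R * Q.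
have [B BE] : exists B : {poly Zp}, (1 + p%:R * 'X) ^+ (p ^ tau * (p - 1))
    = 1 + p%:R ^+ tau.+1 * (p%:R * B - 'X).
  exists ('X + (p - 1)%:R * Q + p%:R ^+ tau * ('C(p - 1, 2))%:R * W ^+ 2
  + p%:R ^+ tau * p%:R ^+ tau.+1 * W ^+ 3 * r).
  rewrite exprM QE rE -/W; set B := 'X + _ + _ + _.
  have -> : p%:R * B - 'X = (p - 1)%:R * W + p%:R * (p%:R ^+ tau * ('C(p - 1, 2))%:R * W ^+ 2
      + p%:R ^+ tau * p%:R ^+ tau.+1 * W ^+ 3 * r).
    by rewrite /B /W p1; ring.
  by rewrite !exprS; ring.
have [z zE] := padic_fixed_point B (- c).
exists (1 + p%:R * z).
  apply/eqP => z0; suff /pdvd_nat : pdvd 1 (1%:R).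
    by rewrite expn1 dvdn1 => /eqP p1'; move: p_pr; rewrite p1'.
  by exists (- z); rewrite expr1 mulrN -[LHS]subr0 -z0; ring.
have := congr1 (horner^~ z) BE.
rewrite !(hornerE, horner_exp) -!polyC_natr !hornerC => ->; congr (_ + _ * _).
by rewrite {2}zE; ring.
Qed.

End PadicIntegers.

(** * Lifting zero sums to p-adic zeros *)

Section Lifting.
Context (p : nat) (p_pr : prime p) (p_odd : odd p) (tau : nat).
Local Notation Zp := (padic_int p_pr).
Local Notation d := (p ^ tau * (p - 1))%N.
Local Notation q := (p ^ tau.+1)%N.

Lemma degree_gt0 : (0 < d)%N.
Proof. by rewrite muln_gt0 expn_gt0 prime_gt0 // subn_gt0 prime_gt1. Qed.

(** Cramer's rule: the determinant is a unit, so the error p^(tau+1) (X, Y) is a combination of the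
    two vectors with coefficients in p^(tau+1) Z_p, and 1 plus such a coefficient is a d-th
    power. *)
Lemma hensel_two (x1 y1 x2 y2 rx ry : Zp) :
  ~ pdvd 1 (x1 * y2 - y1 * x2) ->
  pdvd tau.+1 (x1 + x2 + rx) -> pdvd tau.+1 (y1 + y2 + ry) ->
  exists t1 t2 : Zp, [/\ t1 != 0, x1 * t1 ^+ d + x2 * t2 ^+ d + rx = 0
    & y1 * t1 ^+ d + y2 * t2 ^+ d + ry = 0].
Proof.
move=> /padic_unit_inv[w detw] [X XE] [Y YE].
have [t1 t1_0 t1E] := padic_dth_root tau (w * (x2 * Y - y2 * X)) p_odd.
have [t2 _ t2E] := padic_dth_root tau (w * (y1 * X - x1 * Y)) p_odd.
exists t1, t2; rewrite t1E t2E; split=> //.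
  rewrite (_ : rx = p%:R ^+ tau.+1 * X - x1 - x2); last by rewrite -XE; ring.
  rewrite [LHS](_ : _ = p%:R ^+ tau.+1 * X * (1 - (x1 * y2 - y1 * x2) * w)).
    by rewrite detw subrr mulr0.
  by ring.
rewrite (_ : ry = p%:R ^+ tau.+1 * Y - y1 - y2); last by rewrite -YE; ring.
rewrite [LHS](_ : _ = p%:R ^+ tau.+1 * Y * (1 - (x1 * y2 - y1 * x2) * w)).
  by rewrite detw subrr mulr0.
by ring.
Qed.

Lemma hensel_one (x r : Zp) :
  ~ pdvd 1 x -> pdvd tau.+1 (x + r) ->
  exists2 t : Zp, t != 0 & x * t ^+ d + r = 0.
Proof.
move=> /padic_unit_inv[w xw] [X XE].
have [t t0 tE] := padic_dth_root tau (- (w * X)) p_odd.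
exists t => //; rewrite tE (_ : r = p%:R ^+ tau.+1 * X - x); last by rewrite -XE; ring.
rewrite [LHS](_ : _ = p%:R ^+ tau.+1 * X * (1 - x * w)); last by ring.
by rewrite xw subrr mulr0.
Qed.

Lemma pdvd1_subn (a b : nat) : pdvd 1 (a%:R - b%:R : Zp) <-> a%:R = b%:R :> 'F_p.
Proof.
have p1 : (p - 1)%:R = p%:R - 1 :> Zp by rewrite natrB // prime_gt0.
(* Here (p - 1) b stands for -b, as [pdvd_nat] concerns natural numbers. *)
have eqE : (p ^ 1 %| a + (p - 1) * b)%N <-> a%:R = b%:R :> 'F_p.
  rewrite expn1 (dvdn_pcharf (pchar_Fp p_pr)) natrD natrM natrB ?prime_gt0 //.
  rewrite (pcharf0 (pchar_Fp p_pr)) sub0r mulN1r subr_eq0.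
  by split=> [/eqP|/eqP].
rewrite -eqE -(pdvd_nat p_pr 1).
have pb : pdvd 1 (p%:R * b%:R : Zp) by exists b%:R; rewrite expr1.
rewrite natrD natrM p1; split=> h.
  have -> : a%:R + (p%:R - 1) * b%:R = (a%:R - b%:R) + p%:R * b%:R :> Zp by ring.
  exact: pdvdD.
have -> : a%:R - b%:R = (a%:R + (p%:R - 1) * b%:R) - p%:R * b%:R :> Zp by ring.
exact: pdvdB.
Qed.

(** Two of the partial sums agree mod [n], and the terms between them form [U]. *)
Lemma zero_sum_cyclic (I : finType) (y : I -> nat) (W : {set I}) (n : nat) :
  (0 < n <= #|W|)%N ->
  exists2 U : {set I}, U \subset W & (U != set0) && (n %| \sum_(i in U) y i)%N.
Proof.
move=> /andP[n_gt0 n_le]; pose e := enum W.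
have size_e : size e = #|W| by rewrite /e -cardE.
pose f (m : 'I_(size e).+1) := Ordinal (ltn_pmod (\sum_(i <- take m e) y i) n_gt0).
have [z] : exists z, (1 < #|[set m in setT | f m == z]|)%N.
  by apply: pigeonhole; rewrite cardsT !card_ord mul1n ltnS size_e.
case/card_gt1P => m1 [m2 []]; rewrite !inE /= => /eqP f1 /eqP f2 neq.
wlog lt12 : m1 m2 f1 f2 neq / (m1 < m2)%N.
  move=> H; case: (ltngtP m1 m2) => [lt|gt|/val_inj e12].
  - exact: H f1 f2 neq lt.
  - by apply: H f2 f1 _ gt; rewrite eq_sym.
  - by rewrite e12 eqxx in neq.
pose l := drop m1 (take m2 e).
have ue : uniq l by rewrite drop_uniq ?take_uniq ?enum_uniq.
exists [set i in l].
  by apply/subsetP => i; rewrite inE => /mem_drop/mem_take; rewrite mem_enum.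
apply/andP; split.
  have m2_le : (m2 <= size e)%N by rewrite -ltnS ltn_ord.
  have : (0 < size l)%N by rewrite size_drop size_takel // subn_gt0.
  case: l {ue} => // i l _; apply/set0Pn; exists i; by rewrite inE mem_head.
rewrite (eq_bigl (mem l)) => [|i]; last by rewrite inE.
rewrite -big_uniq //=.
have : (\sum_(i <- take m2 e) y i = \sum_(i <- take m1 e) y i + \sum_(i <- l) y i)%N.
  by rewrite -big_cat /= -(take_takel e (ltnW lt12)) cat_take_drop.
move: f1; rewrite -f2 => /(congr1 val) /= e12 sumE.
rewrite /dvdn -[X in _ == X](mod0n n).
by rewrite -(eqn_modDl (\sum_(i <- take m1 e) y i)) -sumE addn0 e12.
Qed.

(** Natural approximations mod q have a zero-sum subset with an independent pair. Variables outside
    it are set to 0 and those inside to 1, except for the pair, which [hensel_two] adjusts. *)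
Lemma zero_of_levels (I : finType) (X Y : I -> Zp) :
  (4 < p)%N -> (0 < tau)%N ->
  (2 * q <= #|[set i | `[< ~ (pdvd 1 (X i) /\ pdvd 1 (Y i)) >]]| + 1)%N ->
  (4 * q <= #|[set i | `[< ~ (pdvd 2 (X i) /\ pdvd 2 (Y i)) >]]| + 3)%N ->
  (forall i, ~ (pdvd 1 (X i) /\ pdvd 1 (Y i)) ->
     q <= #|[set j | `[< ~ pdvd 1 (X i * Y j - Y i * X j)%R >]]|)%N ->
  exists z : I -> Zp, [/\ exists i, z i != 0, \sum_i X i * z i ^+ d = 0
    & \sum_i Y i * z i ^+ d = 0].
Proof.
move=> p_gt4 tau_gt0 S_ge SM_ge Scl.
have [x xE] := choice (fun i => padic_approx (X i) tau.+1).
have [y yE] := choice (fun i => padic_approx (Y i) tau.+1).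
have xdvd n i : (n <= tau.+1)%N -> (pdvd n (X i) <-> (p ^ n %| x i)%N).
  by move=> n_le; apply/pdvd_natr_congr/(pdvd_leq n_le)/xE.
have ydvd n i : (n <= tau.+1)%N -> (pdvd n (Y i) <-> (p ^ n %| y i)%N).
  by move=> n_le; apply/pdvd_natr_congr/(pdvd_leq n_le)/yE.
have lvl n i : (n <= tau.+1)%N ->
    `[< ~ (pdvd n (X i) /\ pdvd n (Y i)) >] = ~~ ((p ^ n %| x i) && (p ^ n %| y i))%N.
  move=> n_le; apply/asboolP/negP => nd.
    by move=> /andP[/(xdvd n i n_le) ? /(ydvd n i n_le) ?]; apply: nd.
  by move=> [/(xdvd n i n_le) xn /(ydvd n i n_le) yn]; apply: nd; rewrite xn yn.
have primE a b : primitive_mod p a b = ~~ ((p ^ 1 %| a) && (p ^ 1 %| b))%N.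
  by rewrite /primitive_mod expn1 !(dvdn_pcharf (pchar_Fp p_pr)) negb_and.
have parE i j : `[< ~ pdvd 1 (X i * Y j - Y i * X j) >] = ~~ parallel p x y i j.
  have xy1 : pdvd 1 (X i * Y j - Y i * X j) <-> parallel p x y i j.
    have x1 k := pdvd_leq (ltn0Sn tau) (xE k).
    have y1 k := pdvd_leq (ltn0Sn tau) (yE k).
    pose E := X i * (Y j - (y j)%:R) + (X i - (x i)%:R) * (y j)%:R
      - (Y i * (X j - (x j)%:R) + (Y i - (y i)%:R) * (x j)%:R).
    have E1 : pdvd 1 E.
      by apply: pdvdB; apply: pdvdD; [rewrite mulrC| |rewrite mulrC|];
        apply: pdvdMr.
    have detE : X i * Y j - Y i * X j = (x i * y j)%:R - (y i * x j)%:R + E.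
      by rewrite !natrM /E; ring.
    rewrite /parallel -!natrM; split=> [h|/eqP/pdvd1_subn h]; last first.
      by rewrite detE; exact: pdvdD.
    apply/eqP/pdvd1_subn.
    by rewrite -[_ - _](addrK E) -detE; exact: pdvdB.
  by apply/asboolP/negP => h /xy1.
pose S := [set i | ~~ ((p ^ 1 %| x i) && (p ^ 1 %| y i))%N].
(* The vectors divisible by [p] exactly once; since tau >= 1, divisibility by p^2 is visible in the
   approximations mod p^(tau+1). *)
pose M := [set i | ~~ ((p ^ 2 %| x i) && (p ^ 2 %| y i))%N] :\: S.
have SE : [set i | `[< ~ (pdvd 1 (X i) /\ pdvd 1 (Y i)) >]] = S.
  by apply/setP => i; rewrite !inE lvl.
have SME : (#|[set i | `[< ~ (pdvd 2 (X i) /\ pdvd 2 (Y i)) >]]| <= #|S| + #|M|)%N.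
  rewrite -(cardsID S) leq_add //.
    by apply/subset_leq_card/subsetIr.
  by apply/subset_leq_card/subsetP => i; rewrite !inE lvl.
rewrite SE in S_ge.
have [||||||U zU [i [j [iU jU ij]]]] :=
  @spanning_zero_sum_two_levels p tau I x y (fun i => x i %/ p)%N
   (fun i => y i %/ p)%N S M p_pr p_gt4 p_odd tau_gt0.
- move=> j; rewrite !inE negbK expn1 => /andP[/andP[px py] npp].
  rewrite ![(p * _)%N]mulnC !divnK //; split=> //; rewrite primE !expn1.
  by move: npp; rewrite expnS expn1 !dvdn_divRL // !mulnn.
- by rewrite -setI_eq0 /M setDE setICA setICr setI0.
- by move=> i; rewrite inE primE.
- move=> i iS; apply: leq_trans (Scl i _) _.
    by apply/asboolP; rewrite lvl //; rewrite inE in iS.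
  apply/subset_leq_card/subsetP => j; rewrite !inE parE => ij; rewrite ij andbT.
  apply: contra ij; rewrite /parallel expn1 !(dvdn_pcharf (pchar_Fp p_pr)).
  by move=> /andP[/eqP-> /eqP->]; rewrite !mulr0.
- exact: S_ge.
- by lia.
move: zU => /andP[].
have neij : i != j by apply: contraNneq ij => ->; rewrite /parallel mulrC.
have jUi : j \in U :\ i by rewrite !inE eq_sym neij.
have sumE (V : zmodType) (F : I -> V) :
    \sum_(t in U) F t = F i + F j + \sum_(t in U :\ i :\ j) F t.
  by rewrite (big_setD1 i) //= (big_setD1 j) //= addrA.
have sumdvd (Z : I -> Zp) (z : I -> nat) :
    (forall i, pdvd tau.+1 (Z i - (z i)%:R)) -> (q %| \sum_(t in U) z t)%N ->
    pdvd tau.+1 (Z i + Z j + \sum_(t in U :\ i :\ j) Z t).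
  move=> ZE zU; rewrite -sumE.
  rewrite (_ : \sum_(t in U) Z t = \sum_(t in U) (Z t - (z t)%:R) + (\sum_(t in U) z t)%:R).
    by apply: pdvdD; [exact: pdvd_sum|exact/pdvd_nat].
  by rewrite natr_sum -big_split /=; apply: eq_bigr => t _; rewrite subrK.
move=> /(sumdvd X x xE) Xsum /(sumdvd Y y yE) Ysum.
have ndet : ~ pdvd 1 (X i * Y j - Y i * X j) by apply/asboolP; rewrite parE.
have [t1 [t2 [t1_0 Xt Yt]]] := hensel_two ndet Xsum Ysum.
pose z t := if t == i then t1 else if t == j then t2 else (t \in U)%:R.
have zsum (Z : I -> Zp) :
    \sum_t Z t * z t ^+ d = Z i * t1 ^+ d + Z j * t2 ^+ d + \sum_(t in U :\ i :\ j) Z t.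
  rewrite (bigID (mem U)) /= [X in _ + X]big1 ?addr0 => [|t tU]; last first.
    rewrite /z (negPf tU); case: eqP => [ti|_]; first by rewrite ti iU in tU.
    case: eqP => [tj|_]; first by rewrite tj jU in tU.
    by rewrite expr0n gtn_eqF ?degree_gt0 // mulr0.
  rewrite sumE /z eqxx eq_sym (negPf neij) eqxx; congr (_ + _).
  apply: eq_bigr => t; rewrite !inE => /and3P[/negPf-> /negPf-> ->].
  by rewrite expr1n mulr1.
exists z; split; rewrite ?zsum //.
by exists i; rewrite /z eqxx.
Qed.

End Lifting.

(** [bichromatic_pair] peels off [r] disjoint pairs of distinct colours; the bounds for [e] are
    summed over them. *)
Lemma bichromatic_matching_sum (T : finType) (C : eqType) (c : T -> C)
    (g : T -> nat) (e B r : nat) (W : {set T}) :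
  #|W| = r.*2 ->
  (forall x, x \in W -> #|[set y in W | c y == c x]| <= r)%N ->
  (forall x y, c x != c y -> e <= g x + g y + B)%N ->
  (r * e <= \sum_(x in W) g x + r * B)%N.
Proof.
move=> + + gB; elim: r W => [//|r IHr] W cardW Wcl.
have [|x xW|x [y [xW yW xy cardW' Wcl']]] := @bichromatic_pair T C c W r.
- by rewrite cardW.
- by have := Wcl x xW; rewrite cardW; lia.
have yWx : y \in W :\ x by rewrite !inE yW andbT; apply: contraNneq xy => ->.
have W'E : W :\ x :\ y = W :\: [set x; y].
  by apply/setP => t; rewrite !inE negb_or; case: (t \in W); rewrite ?andbF ?andbT // andbC.
have card' : #|W :\: [set x; y]| = r.*2 by lia.
rewrite (big_setD1 x) //= (big_setD1 y) //= W'E; have exy := gB x y xy.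
have IH : (r * e <= \sum_(t in W :\: [set x; y]) g t + r * B)%N.
  by apply: IHr => // z zW'; have := Wcl' z zW'; lia.
rewrite !mulSn; move: IH exy; set s := (\sum_(x in _) _)%N.
by move: (r * e)%N (r * B)%N (g x) (g y) => *; lia.
Qed.

(** * A single form in many variables *)

Section Systems.
Context (p : nat) (p_pr : prime p) (p_odd : odd p) (tau : nat).
Local Notation Zp := (padic_int p_pr).
Local Notation d := (p ^ tau * (p - 1))%N.
Local Notation q := (p ^ tau.+1)%N.

(** Write a_i = p^(l_i) u_i with u_i a unit. At least q of the l_i agree mod d, some of the
    corresponding u_i have sum zero mod q, and [hensel_one] corrects one variable. *)
Lemma zero_of_one_form (I : finType) (a : I -> Zp) (W : {set I}) :
  (forall i, i \in W -> a i != 0) -> (d * (q - 1) < #|W|)%N ->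
  exists z : I -> Zp, [/\ exists i, z i != 0, forall i, i \notin W -> z i = 0
    & \sum_i a i * z i ^+ d = 0].
Proof.
move=> a_neq0 W_gt; have d_gt0 := degree_gt0 p_pr tau.
have val_a i : exists lu : nat * Zp,
    i \in W -> a i = p%:R ^+ lu.1 * lu.2 /\ ~ pdvd 1 lu.2.
  have [iW|niW] := boolP (i \in W); last by exists (0%N, 0).
  by have [l [u alu]] := padic_val (a_neq0 i iW); exists (l, u).
have [lu luE] := choice val_a.
pose l i := (lu i).1; pose u i := (lu i).2.
have [rho rho_gt] : exists z, (q - 1 < #|[set i in W | Ordinal (ltn_pmod (l i) d_gt0) == z]|)%N.
  by apply: pigeonhole; rewrite card_ord mulnC.
set V := [set i in W | _] in rho_gt.
have [y yE] := choice (fun i => padic_approx (u i) tau.+1).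
have [|U UV /andP[U0 sumU]] := @zero_sum_cyclic I y V q.
  by rewrite expn_gt0 prime_gt0 //=; lia.
have UW i : i \in U -> i \in W by move/(subsetP UV); rewrite inE => /andP[].
pose k i := (l i %/ d)%N; pose K := (\sum_i k i)%N.
have lE i : i \in U -> (l i = k i * d + rho)%N.
  move/(subsetP UV); rewrite inE => /andP[_ /eqP/(congr1 val) /= <-].
  exact: divn_eq.
have kK i : (k i <= K)%N by rewrite /K (bigD1 i) //= leq_addr.
have [b bU] := set0Pn _ U0.
have [||t t0 tE] := @hensel_one p p_pr p_odd tau (u b) (\sum_(i in U :\ b) u i).
- by have [] := luE b (UW b bU).
- rewrite -(big_setD1 b) //=.
  rewrite (_ : \sum_(i in U) u i = \sum_(i in U) (u i - (y i)%:R) + (\sum_(i in U) y i)%:R).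
    by apply: pdvdD; [exact: pdvd_sum|exact/pdvd_nat].
  by rewrite natr_sum -big_split /=; apply: eq_bigr => i _; rewrite subrK.
(* The powers of [p] bring all terms to the common factor p^(rho + K d); [K] is an upper bound for
   the [k i] that keeps the exponents nonnegative. *)
pose z i : Zp := p%:R ^+ (K - k i) * (if i == b then t else (i \in U)%:R).
have term i (s : Zp) : i \in U ->
    a i * (p%:R ^+ (K - k i) * s) ^+ d = p%:R ^+ (rho + K * d) * (u i * s ^+ d).
  move=> iU; rewrite (luE i (UW i iU)).1 -/(l i) -/(u i) (lE i iU) exprMn -exprM.
  rewrite (_ : (rho + K * d = (k i * d + rho) + (K - k i) * d)%N).
    by rewrite [in RHS]exprD; ring.
  by rewrite mulnBl; have := leq_mul (kK i) (leqnn d); lia.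
exists z; split.
- by exists b; rewrite /z eqxx mulf_neq0 // expf_neq0 // p_neq0.
- move=> i iW; have iU : i \notin U by apply: contra iW => /UW.
  rewrite /z (negPf iU) ifN ?mulr0 //; apply: contraNneq iU => ->; exact: bU.
rewrite (bigID (mem U)) /= [X in _ + X]big1 ?addr0 => [|i iU]; last first.
  rewrite /z (negPf iU) ifN ?mulr0 ?expr0n ?gtn_eqF ?mulr0 //.
  by apply: contraNneq iU => ->.
rewrite (big_setD1 b) //= /z eqxx term // (eq_bigr (fun i => p%:R ^+ (rho + K * d) * u i)).
  by rewrite -mulr_sumr -mulrDr tE mulr0.
move=> i; rewrite !inE => /andP[/negPf-> iU].
by rewrite term // iU expr1n mulr1.
Qed.

End Systems.

(** * Normalisation of pairs of forms *)

Section Normalisation.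
Context (p : nat) (p_pr : prime p) (d : nat) (I : finType).
Local Notation Zp := (padic_int p_pr).
Implicit Types (a b X Y : I -> Zp) (k : I -> nat).

Definition cross a b i j : Zp := a i * b j - b i * a j.

(* (X, Y) is obtained from (a, b) by scaling the variables by the p ^ k i and
   applying the inverse of a 2x2 matrix whose determinant is divisible by p ^ e. *)
Definition equivalent_system a b k X Y (e : nat) : Prop :=
  exists n11 n12 n21 n22 : Zp,
    [/\ pdvd e (n11 * n22 - n12 * n21),
        forall i, p%:R ^+ (d * k i) * a i = n11 * X i + n12 * Y i
      & forall i, p%:R ^+ (d * k i) * b i = n21 * X i + n22 * Y i].

Lemma equivalent_system_zero a b k X Y e (z : I -> Zp) :
  equivalent_system a b k X Y e ->
  (exists i, z i != 0) -> \sum_i X i * z i ^+ d = 0 -> \sum_i Y i * z i ^+ d = 0 ->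
  exists t : I -> Zp, [/\ exists i, t i != 0, \sum_i a i * t i ^+ d = 0
    & \sum_i b i * t i ^+ d = 0].
Proof.
move=> [n11 [n12 [n21 [n22 [_ aE bE]]]]] [i zi] X0 Y0.
have comb (u : I -> Zp) m1 m2 :
    (forall i, p%:R ^+ (d * k i) * u i = m1 * X i + m2 * Y i) ->
    \sum_i u i * (p%:R ^+ k i * z i) ^+ d = 0.
  move=> uE; transitivity (m1 * (\sum_i X i * z i ^+ d) + m2 * (\sum_i Y i * z i ^+ d)).
    rewrite !mulr_sumr -big_split /=; apply: eq_bigr => j _.
    transitivity (p%:R ^+ (d * k j) * u j * z j ^+ d); last by rewrite uE; ring.
    by rewrite exprMn -exprM [(k j * d)%N]mulnC; ring.
  by rewrite X0 Y0 !mulr0 addr0.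
exists (fun i => p%:R ^+ k i * z i); split; [|exact: comb aE|exact: comb bE].
by exists i; rewrite mulf_neq0 // expf_neq0 // p_neq0.
Qed.

(** The 2x2 determinants of the scaled system equal det N times those of (X, Y), so p^e divides p^(d
    k_i + d k_j) times the original determinant. [B] sums, over all pairs, exponents exceeding the
    valuations of the nonzero determinants. *)
Lemma equivalent_system_bound a b : exists B, forall k X Y e,
  equivalent_system a b k X Y e ->
  forall i j, cross a b i j != 0 -> (e <= d * k i + d * k j + B)%N.
Proof.
have nP (ij : I * I) : exists n, cross a b ij.1 ij.2 != 0 ->
    ~ pdvd n (cross a b ij.1 ij.2).
  have [c0|c0] := pselect (cross a b ij.1 ij.2 = 0); first by exists 0%N; rewrite c0 eqxx.
  apply: contrapT => nex; apply: c0; apply: padic_separated => n.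
  by apply: contrapT => ndvd; apply: nex; exists n.
have [n nE] := choice nP; exists (\sum_ij n ij)%N.
move=> k X Y e [n11 [n12 [n21 [n22 [det_e aE bE]]]]] i j cij.
have n_le : (n (i, j) <= \sum_ij n ij)%N by rewrite (bigD1 (i, j)) //= leq_addr.
rewrite leqNgt; apply/negP => e_gt; have := nE (i, j) cij; apply.
apply: (@pdvd_cancel _ _ (d * k i + d * k j)).
have -> : p%:R ^+ (d * k i + d * k j) * cross a b (i, j).1 (i, j).2
    = (n11 * n22 - n12 * n21) * (X i * Y j - Y i * X j).
  rewrite exprD /cross /=.
  transitivity ((p%:R ^+ (d * k i) * a i) * (p%:R ^+ (d * k j) * b j)
    - (p%:R ^+ (d * k i) * b i) * (p%:R ^+ (d * k j) * a j)); first by ring.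
  by rewrite !aE !bE; ring.
by apply: pdvdMr; apply: pdvd_leq det_e; lia.
Qed.

Lemma cross_trans a b i t j : a t != 0 \/ b t != 0 ->
  cross a b i t = 0 -> cross a b j t = 0 -> cross a b i j = 0.
Proof.
move=> t0 /eqP; rewrite subr_eq0 => /eqP it /eqP; rewrite subr_eq0 => /eqP jt.
have ca : cross a b i j * a t = 0.
  transitivity (a i * (b j * a t) - (b i * a t) * a j); first by rewrite /cross; ring.
  by rewrite -it -jt; ring.
have cb : cross a b i j * b t = 0.
  transitivity ((a i * b t) * b j - b i * (a j * b t)); first by rewrite /cross; ring.
  by rewrite it jt; ring.
case: t0 => t0; apply/eqP.
  by have /eqP := ca; rewrite mulf_eq0 (negPf t0) orbF.
by have /eqP := cb; rewrite mulf_eq0 (negPf t0) orbF.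
Qed.

Lemma cross_antisym a b i j : cross a b j i = - cross a b i j.
Proof. by rewrite /cross; ring. Qed.

(* The index set is doubled so that a perfect matching of non-parallel vectors
   exists even when #|I| is odd. *)
Lemma equivalent_system_index_bound a b :
  (forall i, a i != 0 \/ b i != 0) ->
  (forall i, #|[set j | (cross a b i j == 0)%R]|.*2 <= #|I|)%N ->
  exists B, forall k X Y e, equivalent_system a b k X Y e ->
    (#|I| * e <= 2 * d * (\sum_i k i) + #|I| * B)%N.
Proof.
move=> ab0 cl; have [B BP] := equivalent_system_bound a b; exists B => k X Y e eqv.
(* The colour is the whole parallel class, so distinct colours mean a nonzero determinant. *)
pose c (x : I * bool) := [set j | cross a b x.1 j == 0].
have cE i j : cross a b i j = 0 -> [set t | cross a b i t == 0] = [set t | cross a b j t == 0].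
  move=> ij; apply/setP => t; rewrite !inE; apply/eqP/eqP => h.
    apply: (cross_trans (ab0 i)); first by rewrite cross_antisym ij oppr0.
    by rewrite cross_antisym h oppr0.
  by apply: (cross_trans (ab0 j)) => //; rewrite cross_antisym h oppr0.
have := @bichromatic_matching_sum _ _ c (fun x => d * k x.1)%N e B #|I| setT.
rewrite cardsT card_prod card_bool muln2 => /(_ erefl) H.
apply: leq_trans (H _ _) _.
- move=> x _; apply: leq_trans (cl x.1).
  rewrite -muln2 -card_bool -cardsT -cardsX; apply/subset_leq_card/subsetP => y.
  rewrite !inE andbT /= => /eqP yx.
  have : y.1 \in c y by rewrite inE /cross mulrC subrr.
  by rewrite yx inE.
- move=> x y; apply: contraNT => small.
  apply/eqP; apply: cE; apply/eqP; apply: contraNT small => xy.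
  exact: BP eqv _ _ xy.
rewrite leq_add2r (eq_bigr (fun x => d * k x.1)%N) => [|x _]; last by [].
rewrite (eq_bigl xpredT) => [|x]; last by rewrite inE.
rewrite -(pair_bigA _ (fun i (_ : bool) => d * k i)%N) /= big_distrr /=.
by apply: leq_sum => i _; rewrite sum_nat_const card_bool mulnA.
Qed.

(** Adding the constant #|I| B turns the quantity to be minimised into a natural number, so a
    minimum exists; the identity transformation is a candidate. *)
Lemma minimal_equivalent_system a b :
  (forall i, a i != 0 \/ b i != 0) ->
  (forall i, #|[set j | (cross a b i j == 0)%R]|.*2 <= #|I|)%N ->
  exists k X Y e, equivalent_system a b k X Y e /\
    forall k' X' Y' e', equivalent_system a b k' X' Y' e' ->
      (2 * d * (\sum_i k i) + #|I| * e' <= 2 * d * (\sum_i k' i) + #|I| * e)%N.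
Proof.
move=> ab0 cl; have [B BP] := equivalent_system_index_bound ab0 cl.
pose P n := `[< exists k X Y e, equivalent_system a b k X Y e /\
  (n + #|I| * e = 2 * d * (\sum_i k i) + #|I| * B)%N >].
have PI k X Y e : equivalent_system a b k X Y e ->
    P (2 * d * (\sum_i k i) + #|I| * B - #|I| * e)%N.
  by move=> eqv; apply/asboolP; exists k, X, Y, e; split=> //; rewrite subnK // (BP _ _ _ _ eqv).
have exP : exists n, P n.
  eexists; apply: (PI (fun=> 0%N) a b 0%N).
  exists 1, 0, 0, 1; split; first exact: pdvd0.
    by move=> i; rewrite muln0 expr0; ring.
  by move=> i; rewrite muln0 expr0; ring.
case: (ex_minnP exP) => n /asboolP[k [X [Y [e [eqv nE]]]]] nmin.
exists k, X, Y, e; split=> // k' X' Y' e' eqv'.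
have := nmin _ (PI _ _ _ _ eqv'); have := BP _ _ _ _ eqv'; move: nE.
by move: (2 * d * _)%N (2 * d * _)%N (#|I| * e')%N (#|I| * e)%N (#|I| * B)%N => *; lia.
Qed.

Section Minimal.
Context (a b : I -> Zp) (k : I -> nat) (X Y : I -> Zp) (e : nat).
Context (eqv : equivalent_system a b k X Y e).
Context (kmin : forall k' X' Y' e', equivalent_system a b k' X' Y' e' ->
  (2 * d * (\sum_i k i) + #|I| * e' <= 2 * d * (\sum_i k' i) + #|I| * e)%N).

(** Scaling the variables in [U] by [p] raises the minimised quantity by 2d #|U|, and gaining [f] in
    the determinant exponent lowers it by #|I| f. *)
Lemma minimal_move (U : {set I}) X' Y' f :
  equivalent_system a b (fun i => k i + (i \in U))%N X' Y' (f + e) ->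
  (#|I| * f <= 2 * d * #|U|)%N.
Proof.
move/kmin; rewrite big_split /=.
have -> : (\sum_i (i \in U) = #|U|)%N.
  by rewrite -sum1_card [RHS]big_mkcond; apply: eq_bigr => i _; case: ifP.
rewrite !mulnDr; lia.
Qed.

(** Scaling the variables of the vectors not divisible by p^j makes all vectors divisible by p^j, as
    j <= d. Dividing both rows by p^j then gains 2j in the exponent. *)
Lemma minimal_level_card (j : nat) : (j <= d)%N ->
  (#|I| * j <= d * #|[set i | `[< ~ (pdvd j (X i) /\ pdvd j (Y i)) >]]|)%N.
Proof.
move=> j_le; set U := [set i | _].
have divj i : exists xy : Zp * Zp,
    p%:R ^+ (d * (i \in U)) * X i = p%:R ^+ j * xy.1 /\
    p%:R ^+ (d * (i \in U)) * Y i = p%:R ^+ j * xy.2.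
  have [iU|] := boolP (i \in U).
    exists (p%:R ^+ (d - j) * X i, p%:R ^+ (d - j) * Y i).
    by rewrite muln1 !mulrA -exprD subnKC.
  rewrite inE => /asboolPn/contrapT[[x xE] [y yE]]; exists (x, y).
  by rewrite muln0 expr0 !mul1r.
have [xy xyE] := choice divj.
have eqv' : equivalent_system a b (fun i => k i + (i \in U))%N
    (fun i => (xy i).1) (fun i => (xy i).2) ((j + j) + e).
  have [n11 [n12 [n21 [n22 [det_e aE bE]]]]] := eqv.
  exists (p%:R ^+ j * n11), (p%:R ^+ j * n12), (p%:R ^+ j * n21), (p%:R ^+ j * n22).
  have comb u m1 m2 i : p%:R ^+ (d * k i) * u = m1 * X i + m2 * Y i ->
      p%:R ^+ (d * (k i + (i \in U))) * u
      = p%:R ^+ j * m1 * (xy i).1 + p%:R ^+ j * m2 * (xy i).2.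
    move=> uE; have [xE yE] := xyE i.
    transitivity (m1 * (p%:R ^+ j * (xy i).1) + m2 * (p%:R ^+ j * (xy i).2)); last by ring.
    by rewrite -xE -yE mulnDr exprD mulrAC uE; ring.
  split; [|by move=> i; apply/comb/aE|by move=> i; apply/comb/bE].
  rewrite (_ : _ - _ = p%:R ^+ (j + j) * (n11 * n22 - n12 * n21)); last by rewrite exprD; ring.
  by apply: pdvdM det_e; rewrite -[_ ^+ _]mulr1; exact: pdvd_exp.
by have := minimal_move eqv'; rewrite addnn -mul2n mulnCA -mulnA leq_pmul2l.
Qed.

(** Once the variables off the line of [i0] are scaled, all vectors lie in the lattice spanned by
    the vector [i0] and p Z_p^2. It has index p, so coordinates in it gain 1 in the exponent. *)
Lemma minimal_cross_card i0 : ~ (pdvd 1 (X i0) /\ pdvd 1 (Y i0)) -> (0 < d)%N ->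
  (#|I| <= 2 * d * #|[set j | `[< ~ pdvd 1 (cross X Y i0 j) >]]|)%N.
Proof.
move=> prim d_gt0; set U := [set j | _].
have divc j : exists c, p%:R ^+ (d * (j \in U)) * cross X Y i0 j = p%:R * c.
  have [jU|] := boolP (j \in U).
    exists (p%:R ^+ (d - 1) * cross X Y i0 j).
    by rewrite muln1 -{1}(subnK d_gt0) addn1 exprS mulrA.
  by rewrite inE => /asboolPn/contrapT[c ->]; exists c; rewrite muln0 expr0 mul1r expr1.
have [c cE] := choice divc.
suff [X' [Y' eqv']] : exists X' Y',
    equivalent_system a b (fun i => k i + (i \in U))%N X' Y' (1 + e).
  by have := minimal_move eqv'; rewrite muln1.
have [n11 [n12 [n21 [n22 [det_e aE bE]]]]] := eqv.
pose s j : Zp := p%:R ^+ (d * (j \in U)).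
have aE' i : p%:R ^+ (d * (k i + (i \in U))) * a i = s i * (n11 * X i + n12 * Y i).
  by rewrite -aE mulnDr exprD /s; ring.
have bE' i : p%:R ^+ (d * (k i + (i \in U))) * b i = s i * (n21 * X i + n22 * Y i).
  by rewrite -bE mulnDr exprD /s; ring.
have pdvd1p (u : Zp) : pdvd 1 (p%:R * u) by exists u; rewrite expr1.
(* The lattice basis is the vector [i0] together with p times the second or the first unit vector,
   according to which entry of the vector [i0] is a unit. *)
have [/padic_unit_inv[w Xw]|X1] := pselect (~ pdvd 1 (X i0)).
  exists (fun j => s j * (X j * w)), (fun j => c j * w).
  have comb m1 m2 j : s j * (m1 * X j + m2 * Y j)
      = (m1 * X i0 + m2 * Y i0) * (s j * (X j * w)) + (m2 * p%:R) * (c j * w).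
    transitivity ((m1 * X i0 + m2 * Y i0) * (s j * (X j * w)) + m2 * (p%:R * c j) * w); last by ring.
    rewrite -cE -/(s j) /cross.
    transitivity (s j * (m1 * X j + m2 * Y j) * (X i0 * w)); first by rewrite Xw mulr1.
    by ring.
  exists (n11 * X i0 + n12 * Y i0), (n12 * p%:R), (n21 * X i0 + n22 * Y i0), (n22 * p%:R).
  split; [|by move=> j; rewrite aE' comb|by move=> j; rewrite bE' comb].
  rewrite (_ : _ - _ = (p%:R * X i0) * (n11 * n22 - n12 * n21)); last by ring.
  exact: pdvdM.
have /padic_unit_inv[w Yw] : ~ pdvd 1 (Y i0).
  by move=> Y1; apply: prim; split=> //; apply: contrapT.
exists (fun j => s j * (Y j * w)), (fun j => - (c j * w)).
have comb m1 m2 j : s j * (m1 * X j + m2 * Y j)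
    = (m1 * X i0 + m2 * Y i0) * (s j * (Y j * w)) + (m1 * p%:R) * - (c j * w).
  transitivity ((m1 * X i0 + m2 * Y i0) * (s j * (Y j * w)) - m1 * (p%:R * c j) * w); last by ring.
  rewrite -cE -/(s j) /cross.
  transitivity (s j * (m1 * X j + m2 * Y j) * (Y i0 * w)); first by rewrite Yw mulr1.
  by ring.
exists (n11 * X i0 + n12 * Y i0), (n11 * p%:R), (n21 * X i0 + n22 * Y i0), (n21 * p%:R).
split; [|by move=> j; rewrite aE' comb|by move=> j; rewrite bE' comb].
rewrite (_ : _ - _ = (p%:R * - Y i0) * (n11 * n22 - n12 * n21)); last by ring.
exact: pdvdM.
Qed.

End Minimal.
End Normalisation.

(** * Two forms with p-adic integer coefficients *)

Lemma zero_of_two_forms (p : nat) (p_pr : prime p) (tau : nat) (I : finType)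
    (a b : I -> padic_int p_pr) (d := (p ^ tau * (p - 1))%N) :
  odd p -> (4 < p)%N -> (0 < tau)%N -> (2 * d * (p ^ tau.+1 - 1) < #|I|)%N ->
  exists z : I -> padic_int p_pr, [/\ exists i, z i != 0,
    \sum_i a i * z i ^+ d = 0 & \sum_i b i * z i ^+ d = 0].
Proof.
move=> p_odd p_gt4 tau_gt0 I_gt; set q := (p ^ tau.+1)%N in I_gt.
have d_gt0 : (0 < d)%N := degree_gt0 p_pr tau.
have q_gt0 : (0 < q)%N by rewrite expn_gt0 prime_gt0.
have d_ge2 : (2 <= d)%N.
  have : (0 < p ^ tau)%N by rewrite expn_gt0 prime_gt0.
  by rewrite /d; nia.
(* A variable absent from both forms gives a solution by itself. *)
have [[i [ai bi]]|nz] := pselect (exists i, a i = 0 /\ b i = 0).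
  have sum0 (u : I -> padic_int p_pr) : u i = 0 -> \sum_j u j * ((j == i)%:R : padic_int p_pr) ^+ d = 0.
    move=> ui; rewrite (bigD1 i) //= ui mul0r big1 ?addr0 // => j /negPf->.
    by rewrite expr0n gtn_eqF ?mulr0.
  exists (fun j => (j == i)%:R); split; [|exact: sum0|exact: sum0].
  by exists i; rewrite eqxx oner_neq0.
have ab0 i : a i != 0 \/ b i != 0.
  have [ai|] := eqVneq (a i) 0; last by left.
  by right; apply/eqP => bi; apply: nz; exists i.
(* On [W] the vectors are proportional to that of [i], so a zero of [u] supported on [W] is one of
   [v]; and [W] has more than d(q - 1) members. *)
have one (u v : I -> padic_int p_pr) (W : {set I}) i : u i != 0 ->
    (forall j, u j != 0 \/ v j != 0) ->
    (forall j, j \in W -> u i * v j = v i * u j) -> (#|I| < #|W|.*2)%N ->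
    exists z : I -> padic_int p_pr, [/\ exists i, z i != 0,
      \sum_i u i * z i ^+ d = 0 & \sum_i v i * z i ^+ d = 0].
  move=> ui uv0 uvW W_gt.
  have uW j : j \in W -> u j != 0.
    move=> /uvW uvj; have [//|vj] := uv0 j; apply: contraNneq vj => uj.
    by move/eqP: uvj; rewrite uj mulr0 mulf_eq0 (negPf ui).
  have [|z [z0 zW zu]] := zero_of_one_form (tau := tau) p_odd uW; first by rewrite -/d -/q; lia.
  exists z; split=> //; apply: (mulfI ui); rewrite mulr0.
  transitivity (v i * (\sum_j u j * z j ^+ d)); last by rewrite zu mulr0.
  rewrite !mulr_sumr; apply: eq_bigr => j _; rewrite !mulrA.
  have [/uvW->//|/zW->] := boolP (j \in W).
  by rewrite expr0n gtn_eqF ?mulr0.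
have [small|] := pselect (forall i, #|[set j | (cross a b i j == 0)%R]|.*2 <= #|I|)%N; last first.
  move/existsNP => [i /negP]; rewrite -ltnNge; set W := [set j | _] => W_gt.
  have WP j : j \in W -> a i * b j = b i * a j.
    by rewrite inE subr_eq0 => /eqP.
  have [ai|bi] := ab0 i; first exact: one ai ab0 WP W_gt.
  have [|j jW|z [z0 zb za]] := one b a W i bi _ _ W_gt; [|by rewrite WP|by exists z].
  by move=> j; have [|] := ab0 j; [right|left].
have [k [X [Y [e [eqv kmin]]]]] := minimal_equivalent_system d ab0 small.
suff [z [z0 zX zY]] : exists z : I -> padic_int p_pr, [/\ exists i, z i != 0,
    \sum_i X i * z i ^+ d = 0 & \sum_i Y i * z i ^+ d = 0].
  exact: equivalent_system_zero eqv z0 zX zY.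
(* Cancelling d or 2d between #|I| > 2d(q - 1) and the inequalities from minimality gives the counts
   2q - 1, 4q - 3 and q. *)
apply: zero_of_levels => //.
- have := minimal_level_card eqv kmin d_gt0.
  set S := [set _ | _]; rewrite muln1 -/q => le.
  have : (d * (2 * (q - 1)) < d * #|S|)%N by lia.
  by rewrite ltn_pmul2l //; lia.
- have := minimal_level_card eqv kmin d_ge2.
  set S := [set _ | _]; rewrite -/q => le.
  have : (d * (4 * (q - 1)) < d * #|S|)%N by lia.
  by rewrite ltn_pmul2l //; lia.
move=> i /(minimal_cross_card eqv kmin)/(_ d_gt0).
rewrite /cross; set S := [set _ | _]; rewrite -/q => le.
have : (2 * d * (q - 1) < 2 * d * #|S|)%N by lia.
by rewrite ltn_pmul2l ?muln_gt0 //; lia.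
Qed.

(** * The theorem over the p-adic numbers *)

Lemma fraction_denominator (K : idomainType) (x : {fraction K}) :
  exists Dn : K * K, Dn.1 != 0 /\ tofrac Dn.1 * x = tofrac Dn.2.
Proof.
elim/quotW: x => r; exists (\d_r, \n_r); split; first exact: denom_ratioP.
rewrite -[_ * _]/(FracField.mul _ _) !piE; apply/eqmodP => /=.
rewrite FracField.equivfE /FracField.mulf !numden_Ratio ?mulf_neq0 ?oner_neq0 ?denom_ratioP //.
by rewrite mulr1 mul1r mulrC.
Qed.

(** With [D i] a common denominator of the coefficients, [al i] and [be i] are integral expressions
    for a_i D_i^d and b_i D_i^d; the d-th power is absorbed by the variable. *)
Lemma padic_zero_of_two_forms (p : nat) (p_pr : prime p) (tau s : nat)
    (a b : 'I_s -> padic p_pr) (d := (p ^ tau * (p - 1))%N) :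
  odd p -> (4 < p)%N -> (0 < tau)%N -> (2 * d * (p ^ tau.+1 - 1) < s)%N ->
  exists x : 'rV[padic p_pr]_s,
    [/\ x != 0, \sum_(i < s) a i * x 0 i ^+ d = 0
      & \sum_(i < s) b i * x 0 i ^+ d = 0].
Proof.
move=> p_odd p_gt4 tau_gt0 s_gt.
have d_gt0 : (0 < d)%N := degree_gt0 p_pr tau.
have dE : d = d.-1.+1 by rewrite prednK.
have [A AE] := choice (fun i => fraction_denominator (a i)).
have [B BE] := choice (fun i => fraction_denominator (b i)).
pose D i := (A i).1 * (B i).1.
pose al i := (A i).2 * (B i).1 * D i ^+ d.-1.
pose be i := (B i).2 * (A i).1 * D i ^+ d.-1.
have alE i : tofrac (al i) = a i * tofrac (D i) ^+ d.
  rewrite dE exprS /al /D !rmorphM rmorphXn rmorphM /= -(AE i).2; ring.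
have beE i : tofrac (be i) = b i * tofrac (D i) ^+ d.
  rewrite dE exprS /be /D !rmorphM rmorphXn rmorphM /= -(BE i).2; ring.
have [|z [[i zi] za zb]] := @zero_of_two_forms p p_pr tau 'I_s al be p_odd p_gt4 tau_gt0.
  by rewrite card_ord.
exists (\row_i tofrac (D i * z i)); split.
- apply: contraNneq zi => /rowP/(_ i)/eqP; rewrite !mxE tofrac_eq0 mulf_eq0.
  by case/orP => //; rewrite mulf_eq0 (negPf (AE i).1) (negPf (BE i).1).
- transitivity (tofrac (\sum_i al i * z i ^+ d)); last by rewrite za rmorph0.
  rewrite rmorph_sum; apply: eq_bigr => j _.
  by rewrite mxE [tofrac (D j * _)]rmorphM exprMn mulrA -alE -rmorphXn -rmorphM.
- transitivity (tofrac (\sum_i be i * z i ^+ d)); last by rewrite zb rmorph0.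
  rewrite rmorph_sum; apply: eq_bigr => j _.
  by rewrite mxE [tofrac (D j * _)]rmorphM exprMn mulrA -beE -rmorphXn -rmorphM.
Qed.

Theorem theorem1p1 (R : realType) (p : nat) (p_pr : prime p) (p_odd : odd p)
    (tau : nat) (tau_ge1 : (1 <= tau)%N)
    (d : nat) (d_def : d = (p ^ tau * (p - 1))%N)
    (C : R) (C_ge3 : 3 <= C) (C_zero_sum : zero_sum_constant C)
    (s : nat) (a b : 'I_s -> padic p_pr)
    (hyp : [\/ [/\ (3 <= tau)%N,
                   s%:R > 2 * (p%:R / (p%:R - 1)) * d%:R ^+ 2 - 2 * d%:R :> R
                 & (7 <= p)%N],
               [/\ tau = 2%N,
                   s%:R > 2 * (p%:R / (p%:R - 1)) * d%:R ^+ 2 - 2 * d%:R :> R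
                 & p%:R >= C / 2 + 4]
             | [/\ tau = 1%N,
                   s%:R > (2 * (p%:R / (p%:R - 1)) + (C - 3) / (2 * p%:R - 2))
                          * d%:R ^+ 2 - 2 * d%:R
                 & (5 <= p)%N]]) :
  exists x : 'rV[padic p_pr]_s,
    [/\ x != 0,
        \sum_(i < s) a i * x 0 i ^+ d = 0
      & \sum_(i < s) b i * x 0 i ^+ d = 0].
Proof.
have p_gt1 := prime_gt1 p_pr.
have p1_gt0 : 0 < p%:R - 1 :> R by rewrite subr_gt0 ltr1n.
(* In case (ii), C >= 3 forces p >= 11/2; in case (iii) the additional multiple of d^2 is
   nonnegative. *)
have [p_gt4 s_gt] : (4 < p)%N /\
    s%:R > 2 * (p%:R / (p%:R - 1)) * d%:R ^+ 2 - 2 * d%:R :> R.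
  case: hyp => [[_ hs hp]|[_ hs hp]|[_ hs hp]]; split=> //.
  - exact: leq_trans hp.
  - by rewrite -(ltr_nat R); lra.
  - apply: le_lt_trans hs; rewrite lerD2r ler_wpM2r ?exprn_ge0 ?ler0n // lerDl.
    by apply: divr_ge0; lra.
have -> : d = (p ^ tau * (p - 1))%N by [].
apply: padic_zero_of_two_forms => //.
(* Since p d / (p - 1) = p^(tau+1), the bound on [s] equals 2d(p^(tau+1) - 1). *)
rewrite -d_def -(ltr_nat R) !natrM natrB ?expn_gt0 ?prime_gt0 //.
apply: le_lt_trans s_gt; rewrite le_eqVlt; apply/orP; left; apply/eqP.
have -> : d%:R = p%:R ^+ tau * (p%:R - 1) :> R.
  by rewrite d_def natrM natrX natrB // ltnW.
by rewrite natrX exprS; field; rewrite gt_eqF.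
Qed.
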